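(* Let $n$ be a positive integer and $\kappa\in\mathbb{R}$. The class of $n$-dimensional Riemannian manifolds with sectional curvature bounded below by $\kappa$ does not satisfy any uniform $n$-dimensional $(C,\beta)$-tetrahedral property for any radius $r>0$; that is, for every $r>0$, $C>0$ and $\beta\in(0,1)$ there is a manifold in this class that does not satisfy the $n$-dimensional $(C,\beta)$-tetrahedral property for radius $r$. This holds even if the manifolds are required to have diameter bigger than $r$, or if they are required to be closed, i.e. complete and with no boundary.
   Context: Riemannian manifolds are regarded as metric spaces with their Riemannian distance. For a metric space $(X,d)$ with metric completion $\bar X$ (and $d$ extended to $\bar X$), $q\in\bar X$ and $t>0$, put $S(q;t)=\{x\in X: d(x,q)=t\}$. Given $p\in X$, $r>0$, $p_1,\dots,p_{n-1}\in\bar X$ and $t_1,\dots,t_{n-1}>0$, let $S=S(p;r)\cap S(p_1;t_1)\cap\dots\cap S(p_{n-1};t_{n-1})$, and let $h(p,r,t_1,\dots,t_{n-1})=\inf\{d(x,y):x\ne y,\ x,y\in S\}$ if $|S|\ge2$ and $0$ otherwise. For $C>0$, $\beta\in(0,1)$, $(X,d)$ has the $n$-dimensional $(C,\beta)$-tetrahedral property at $p$ for radius $r$ if there exist $p_1,\dots,p_{n-1}\in\bar X$ with $d(p,p_i)=r$ such that $h(p,r,t_1,\dots,t_{n-1})\ge Cr$ for all $(t_1,\dots,t_{n-1})\in[(1-\beta)r,(1+\beta)r]^{n-1}$. It satisfies the property for radius $r$ if it has it at every point $p\in X$ for radius $r$. *)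

(* Defs.v *)
From HB Require Import structures.
From mathcomp Require Import all_boot all_order all_algebra.
From mathcomp Require Import all_classical all_reals all_analysis.

Set Implicit Arguments.
Unset Strict Implicit.
Unset Printing Implicit Defensive.

Import Order.TTheory GRing.Theory Num.Theory.
Import numFieldNormedType.Exports.

Local Open Scope classical_set_scope.
Local Open Scope ring_scope.

(* The metric part is stated for a carrier [X] with a bare distance function
   [d], so that it applies directly to the Riemannian distance. *)
Section MetricSpace.
Context {R : realType} {X : Type} (d : X -> X -> R).

Definition metric_cauchy (u : nat -> X) : Prop :=
  forall e : R, 0 < e ->
    exists N : nat, forall i j : nat, (N <= i)%N -> (N <= j)%N ->
      d (u i) (u j) < e.

Definition metric_complete : Prop :=
  forall u : nat -> X, metric_cauchy u ->
    exists x : X, d x (u k) @[k --> \oo] --> (0 : R).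

(* A point of the metric completion is given by a Cauchy sequence of [X].
   Sequences at distance 0 are not identified: points of the completion are
   only used below through their distances to points of [X]. *)
Record completion := Completion {
  cauchy_rep : nat -> X ;
  cauchy_repP : metric_cauchy cauchy_rep }.

Definition dist_completion (x : X) (q : completion) : R :=
  lim (d x (cauchy_rep q k) @[k --> \oo]).

Definition sphere (p : X) (r : R) : set X := [set x | d x p = r].

Definition sphere_completion (q : completion) (t : R) : set X :=
  [set x | dist_completion x q = t].

Definition sphere_inter m (p : X) (r : R) (q : 'I_m -> completion)
    (t : 'I_m -> R) : set X :=
  sphere p r `&` [set x | forall i, sphere_completion (q i) (t i) x].

Definition tetra_h m (p : X) (r : R) (q : 'I_m -> completion)
    (t : 'I_m -> R) : R :=
  let S := sphere_inter p r q t in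
  if `[< exists x y, [/\ S x, S y & x <> y] >] then
    inf [set l | exists x y, [/\ S x, S y, x <> y & l = d x y]]
  else 0.

Definition tetrahedral_at (n : nat) (C beta : R) (p : X) (r : R) : Prop :=
  exists q : 'I_n.-1 -> completion,
    (forall i, dist_completion p (q i) = r) /\
    forall t : 'I_n.-1 -> R,
      (forall i, (1 - beta) * r <= t i <= (1 + beta) * r) ->
      C * r <= tetra_h p r q t.

Definition tetrahedral (n : nat) (C beta r : R) : Prop :=
  forall p : X, tetrahedral_at n C beta p r.

Definition diameter : \bar R := ereal_sup [set (d z.1 z.2)%:E | z in setT].

End MetricSpace.

Section Euclidean.
Context {R : realType} {n : nat}.

Definition partial (i : 'I_n) (f : 'rV[R]_n -> R) : 'rV[R]_n -> R :=
  'D_(delta_mx 0 i) f.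

Fixpoint Ck_on (k : nat) (U : set 'rV[R]_n) (f : 'rV[R]_n -> R) : Prop :=
  (forall x, U x -> {for x, continuous f}) /\
  (if k is k'.+1 then
     forall i : 'I_n,
       (forall x, U x -> derivable f x (delta_mx 0 i)) /\
       Ck_on k' U (partial i f)
   else True).

Definition smooth_on (U : set 'rV[R]_n) (f : 'rV[R]_n -> R) : Prop :=
  forall k, Ck_on k U f.

Definition smooth_map_on (U : set 'rV[R]_n) (f : 'rV[R]_n -> 'rV[R]_n) : Prop :=
  forall i : 'I_n, smooth_on U (fun x => f x 0 i).

Definition C1_curve (e : R -> 'rV[R]_n) : Prop :=
  (forall s, derivable e s 1) /\ continuous (derive1 e).

Definition inner (G : 'M[R]_n) (u v : 'rV[R]_n) : R := (u *m G *m v^T) 0 0.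

(* [christoffel k i j] has upper index k and lower indices i, j. *)
Section Curvature.
Variable g : 'rV[R]_n -> 'M[R]_n.

Definition christoffel (k i j : 'I_n) (x : 'rV[R]_n) : R :=
  2^-1 * \sum_(l < n) invmx (g x) k l *
    (partial i (fun y => g y j l) x + partial j (fun y => g y i l) x
     - partial l (fun y => g y i j) x).

(* [riemann_coef l i j k] is the component on the l-th coordinate field of
   R(e_i, e_j) e_k, where R(X,Y)Z = D_X D_Y Z - D_Y D_X Z - D_[X,Y] Z. *)
Definition riemann_coef (l i j k : 'I_n) (x : 'rV[R]_n) : R :=
  partial i (christoffel l j k) x - partial j (christoffel l i k) x
  + \sum_(m < n) (christoffel m j k x * christoffel l i m x
                  - christoffel m i k x * christoffel l j m x).

Definition riemann (x u v w : 'rV[R]_n) : 'rV[R]_n :=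
  \row_l \sum_(i < n) \sum_(j < n) \sum_(k < n)
    u 0 i * v 0 j * w 0 k * riemann_coef l i j k x.

Definition sectional_curvature (x u v : 'rV[R]_n) : R :=
  inner (g x) (riemann x u v v) u /
  (inner (g x) u u * inner (g x) v v - inner (g x) u v ^+ 2).

End Curvature.
End Euclidean.

(* Smooth manifolds without boundary: every chart is a homeomorphism onto an
   open subset of R^n (not of a half-space).  They are connected, so that the
   Riemannian distance is finite.  [coord i] and [cpar i] are the chart and its
   inverse; their values off [cdom i] and [cimg i] are irrelevant.  [chart_at]
   selects a chart around each point. *)
Record manifold (R : realType) (n : nat) := Manifold {
  mspace :> topologicalType ;
  chart : Type ;
  cdom : chart -> set mspace ;
  coord : chart -> mspace -> 'rV[R]_n ;
  cpar : chart -> 'rV[R]_n -> mspace ;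
  chart_at : mspace -> chart ;
  _ : hausdorff_space mspace ;
  _ : @second_countable mspace ;
  _ : connected [set: mspace] ;
  _ : forall x, cdom (chart_at x) x ;
  _ : forall i, open (cdom i) ;
  _ : forall i, open (coord i @` cdom i) ;
  _ : forall i x, cdom i x -> cpar i (coord i x) = x ;
  _ : forall i x, cdom i x -> {for x, continuous (coord i)} ;
  _ : forall i y, (coord i @` cdom i) y -> {for y, continuous (cpar i)} ;
  _ : forall i j,
        smooth_map_on (coord i @` (cdom i `&` cdom j)) (coord j \o cpar i) }.

Definition cimg (R : realType) (n : nat) (M : manifold R n) (i : chart M) :
  set 'rV[R]_n := coord i @` cdom i.

Definition transition (R : realType) (n : nat) (M : manifold R n)
  (i j : chart M) : 'rV[R]_n -> 'rV[R]_n := coord j \o cpar i.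

(* [metric i y] is the Gram matrix of the metric in the i-th chart, at the
   point of coordinates [y].  As vectors are rows, the differential of a
   transition map is u |-> u *m 'J. *)
Record riemannian_manifold (R : realType) (n : nat) := RiemannianManifold {
  rmanifold :> manifold R n ;
  metric : chart rmanifold -> 'rV[R]_n -> 'M[R]_n ;
  _ : forall i a b, smooth_on (cimg i) (fun y => metric i y a b) ;
  _ : forall i y, cimg i y -> (metric i y)^T = metric i y ;
  _ : forall i y, cimg i y -> forall u, u != 0 -> 0 < inner (metric i y) u u ;
  _ : forall i j y, (coord i @` (cdom i `&` cdom j)) y ->
        let J := 'J (transition i j) y in
        metric i y = J *m metric j (transition i j y) *m J^T }.

Section RiemannianManifold.
Context {R : realType} {n : nat} (M : riemannian_manifold R n).

(* C^1 on the closed interval [a, b]: near each point, and read in a chart,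
   the curve is the restriction to [a, b] of a C^1 curve. *)
Definition C1_on (c : R -> M) (a b : R) : Prop :=
  forall t, a <= t <= b ->
    exists (i : chart M) (e : R -> 'rV[R]_n) (eps : R),
      [/\ 0 < eps, C1_curve e &
        forall s, a <= s <= b -> `|s - t| < eps ->
          cdom i (c s) /\ coord i (c s) = e s].

Inductive piecewise_C1 (c : R -> M) : R -> R -> Prop :=
| pw_C1 a b : a <= b -> C1_on c a b -> piecewise_C1 c a b
| pw_cat a b d : piecewise_C1 c a b -> piecewise_C1 c b d ->
    piecewise_C1 c a d.

(* The norm of the velocity; it does not depend on the chart.  The values at
   the finitely many breakpoints of a piecewise C^1 curve do not affect its
   length. *)
Definition speed (c : R -> M) (t : R) : R :=
  let i := chart_at (c t) in
  let v := derive1 (coord i \o c) t in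
  Num.sqrt (inner (metric i (coord i (c t))) v v).

Definition curve_length (c : R -> M) : \bar R :=
  (\int[lebesgue_measure]_(t in `[0%R, 1%R]) (speed c t)%:E)%E.

Definition rdist (x y : M) : R :=
  fine (ereal_inf [set l : \bar R | exists c : R -> M,
    [/\ piecewise_C1 c 0 1, c 0 = x, c 1 = y & l = curve_length c]]).

Definition sec_bounded_below (kappa : R) : Prop :=
  forall (i : chart M) (y : 'rV[R]_n), cimg i y ->
    forall u v : 'rV[R]_n, row_free (col_mx u v) ->
      kappa <= sectional_curvature (metric i) y u v.

End RiemannianManifold.

(* Main.v *)
(* A manifold in which some sphere [S(p; r)] has at most one point is not
   tetrahedral at [p] for radius [r], since then [h = 0 < C r].  Curvature at
   least [kappa] is compatible with this in two ways.  A round sphere of radius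
   [rho <= r / pi] is closed, has curvature [rho^-2], and only the antipode of
   [p] can lie at distance [r].  An open box in R^n of length [3 r / 2] in the
   direction [i0] and thin in all others, with the metric [phi^-2 I] where
   [phi = 1 + sum_(i != i0) A x_i^2 / 2], has curvature about at least [A] and
   diameter bigger than [r], but all its points are closer than [r] to its
   centre.  Both metrics have the form [phi^-2 I] with
   [phi = b + sum_i a_i x_i^2 / 2] (the sphere in its stereographic charts), for
   which the [(i, j)] coordinate plane has curvature
   [phi (a_i + a_j) - sum_k (a_k x_k)^2].  Distances are bounded from above by
   the lengths of segments, and from below by means of functions that are
   1-Lipschitz for the metric. *)
From HB Require Import structures.
From mathcomp Require Import all_boot all_order all_algebra.
From mathcomp Require Import finmap.
From mathcomp Require Import all_classical all_reals all_analysis.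
From mathcomp Require Import measurable_realfun.
From mathcomp Require Import ring lra.
Require Import Defs.
Set Implicit Arguments.
Unset Strict Implicit.
Unset Printing Implicit Defensive.
Import Order.TTheory GRing.Theory Num.Theory.
Import numFieldNormedType.Exports.
Local Open Scope classical_set_scope.
Local Open Scope ring_scope.

(** * Functions of class C^k *)

(** Neither example can replace the other: the round sphere has diameter at most [r], and the box is
    not complete. Upper bounds on [rdist] make [S(p; r)] small. Lower bounds are needed twice: for
    the diameter of the box, and for the completeness of the sphere, where a Cauchy sequence for
    [rdist] must be shown to have Cauchy ambient coordinates. Lower bounds are the harder side. The
    length integrates a [speed] that is computed in a chart chosen at each point, takes arbitrary
    values at corners, and is not known to be measurable; it is therefore compared with measurable
    functions below it, built on short intervals where the curve stays in one chart. Moreover a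
    lower bound on [rdist] asks for one explicit curve of finite length between the two points. For
    [n = 1] there are no two independent tangent vectors, so the curvature bound is vacuous and the
    same constructions give an interval and a circle. *)

Lemma near_eq_continuous (T V : topologicalType) (f g : T -> V) (x : T) :
  (\forall z \near x, f z = g z) -> {for x, continuous f} ->
  {for x, continuous g}.
Proof.
move=> fg; rewrite /prop_for /continuous_at -(nbhs_singleton fg).
by move=> cf; apply: cvg_trans cf; exact: near_eq_cvg.
Qed.

Lemma sum_continuous_at (R : realType) (T : topologicalType) m (F : 'I_m -> T -> R) x :
  (forall j, {for x, continuous (F j)}) ->
  {for x, continuous (fun z => \sum_j F j z)}.
Proof.
elim: m F => [|m IH] F cF.
  rewrite (_ : (fun z => _) = cst 0); first exact: cst_continuous.
  by apply/funext => z; rewrite big_ord0.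
rewrite (_ : (fun z => _) = F ord0 \+ (fun z => \sum_j F (lift ord0 j) z)).
  by apply: continuousD; [exact: cF|exact: IH].
by apply/funext => z; rewrite big_ord_recl.
Qed.

Section Smooth.
Context {R : realType} {n : nat}.
Implicit Types (U : set 'rV[R]_n) (f g : 'rV[R]_n -> R).

Lemma Ck_onW k U f : Ck_on k.+1 U f -> Ck_on k U f.
Proof.
elim: k f => [|k IH] f [cf df]; split => // i.
have [dfi Ci] := df i; split => //; exact: IH.
Qed.

Lemma eq_Ck_on k U f g : open U -> (forall x, U x -> f x = g x) ->
  Ck_on k U f -> Ck_on k U g.
Proof.
move=> oU; elim: k f g => [|k IH] f g fg [cf df].
all: have nfg x : U x -> \near x, f x = g x
  by move=> Ux; apply: filterS (open_nbhs_nbhs (conj oU Ux)) => z /fg.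
  by split => // x Ux; exact: near_eq_continuous (nfg x Ux) (cf x Ux).
split=> [x Ux|i]; first exact: near_eq_continuous (nfg x Ux) (cf x Ux).
have [dfi Ci] := df i; split=> [x Ux|].
  exact: near_eq_derivable (nfg x Ux) (dfi x Ux).
by apply: IH Ci => x Ux; apply: near_eq_derive; exact: nfg.
Qed.

Lemma Ck_on_cst k U (c : R) : Ck_on k U (cst c).
Proof.
elim: k c => [|k IH] c; first by split=> // x _; exact: cst_continuous.
split=> [x _|i]; first exact: cst_continuous.
split=> [x _|]; first exact: derivable_cst.
have -> : partial i (cst c) = cst 0 by apply/funext => x; exact: derive_cst.
exact: IH.
Qed.

Lemma is_derive_coord (j : 'I_n) (x v : 'rV[R]_n) :
  is_derive x v (fun y : 'rV[R]_n => y 0 j) (v 0 j).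
Proof.
pose f := fun y : 'rV[R]_n => y 0 j.
have lf : linear f by move=> a y z; rewrite /f !mxE.
pose HM := GRing.isLinear.Build _ _ _ _ f lf.
pose L : {linear 'rV[R]_n -> R} := HB.pack f HM.
have cL : continuous L by exact: coord_continuous.
have dL : differentiable (L : _ -> R) x by exact: differentiable_coord.
apply: DeriveDef; first exact: diff_derivable.
by rewrite -[fun y => _]/(L : _ -> R) deriveE// (diff_lin x cL).
Qed.

Lemma Ck_on_coord k U (j : 'I_n) : Ck_on k U (fun x => x 0 j).
Proof.
case: k => [|k]; first by split=> // x _; exact: coord_continuous.
split=> [x _|i]; first exact: coord_continuous.
split=> [x _|]; first by have [] := is_derive_coord j x (delta_mx 0 i).
have -> : partial i (fun x : 'rV[R]_n => x 0 j) = cst ((delta_mx 0 i : 'rV[R]_n) 0 j).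
  by apply/funext => x; have [] := is_derive_coord j x (delta_mx 0 i).
exact: Ck_on_cst.
Qed.

Lemma Ck_onD k U f g : open U -> Ck_on k U f -> Ck_on k U g -> Ck_on k U (f \+ g).
Proof.
move=> oU; elim: k f g => [|k IH] f g [cf df] [cg dg].
  by split=> // x Ux; apply: continuousD; [exact: cf|exact: cg].
split=> [x Ux|i]; first by apply: continuousD; [exact: cf|exact: cg].
have [dfi Cf] := df i; have [dgi Cg] := dg i; split=> [x Ux|].
  by apply: derivableD; [exact: dfi|exact: dgi].
apply: eq_Ck_on (IH _ _ Cf Cg) => // x Ux /=.
by rewrite /partial deriveD//; [exact: dfi|exact: dgi].
Qed.

Lemma Ck_onM k U f g : open U -> Ck_on k U f -> Ck_on k U g -> Ck_on k U (f \* g).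
Proof.
move=> oU; elim: k f g => [|k IH] f g Cf Cg.
  case: Cf => cf _; case: Cg => cg _.
  by split=> // x Ux; apply: continuousM; [exact: cf|exact: cg].
have Cf' := Ck_onW Cf; have Cg' := Ck_onW Cg.
case: Cf => cf df; case: Cg => cg dg.
split=> [x Ux|i]; first by apply: continuousM; [exact: cf|exact: cg].
have [dfi Cfi] := df i; have [dgi Cgi] := dg i; split=> [x Ux|].
  by apply: derivableM; [exact: dfi|exact: dgi].
apply: eq_Ck_on (Ck_onD oU (IH _ _ Cf' Cgi) (IH _ _ Cg' Cfi)) => // x Ux /=.
by rewrite /partial deriveM//; [exact: dfi|exact: dgi].
Qed.

Lemma Ck_onV k U f : open U -> (forall x, U x -> f x != 0) ->
  Ck_on k U f -> Ck_on k U (fun x => (f x)^-1).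
Proof.
move=> oU f0; elim: k => [|k IH] Cf.
  by case: Cf => cf _; split=> // x Ux; exact: continuousV (f0 x Ux) (cf x Ux).
have Cf' := IH (Ck_onW Cf); case: Cf => cf df.
split=> [x Ux|i]; first by exact: continuousV (f0 x Ux) (cf x Ux).
have [dfi Cfi] := df i; split=> [x Ux|].
  by apply: derivableV; [exact: f0|exact: dfi].
(* The derivative of [1 / f] is [- f^-1 * f^-1 * f'], where [f^-1] is of class C^k by induction. *)
have C1 := Ck_onM oU (Ck_on_cst k U (-1)) (Ck_onM oU (Ck_onM oU Cf' Cf') Cfi).
apply: eq_Ck_on C1 => // x Ux /=.
rewrite /partial (deriveV (f0 x Ux) (dfi x Ux)).
by rewrite /GRing.scale /= expr2 invfM mulN1r mulNr.
Qed.

Lemma Ck_on_sum k U m (F : 'I_m -> 'rV[R]_n -> R) : open U ->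
  (forall i, Ck_on k U (F i)) -> Ck_on k U (fun x => \sum_i F i x).
Proof.
move=> oU CF; elim: m F CF => [|m IH] F CF.
  apply: eq_Ck_on (Ck_on_cst k U 0) => // x _; by rewrite big_ord0.
apply: eq_Ck_on (Ck_onD oU (CF ord0) (IH (fun i => F (lift ord0 i)) _)) => //.
by move=> x _; rewrite big_ord_recl.
Qed.

End Smooth.

(** * Length of curves and Riemannian distance *)

(** The integral of a nonnegative function is the supremum of the integrals of the simple functions
    below it, and a larger function has more of these. Measurability plays no part, which is what
    makes the lemma applicable to [speed]. *)
Lemma le_integral_nonmeasurable d (T : measurableType d) (R : realType)
    (mu : {measure set T -> \bar R}) (D : set T) (f g : T -> \bar R) :
  (forall x, D x -> 0 <= f x)%E -> (forall x, D x -> f x <= g x)%E ->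
  (\int[mu]_(x in D) f x <= \int[mu]_(x in D) g x)%E.
Proof.
move=> f0 fg; rewrite !(integral_mkcond D).
have fgD x : ((f \_ D) x <= (g \_ D) x)%E.
  by rewrite /patch; case: ifPn => // /set_mem /fg.
have fD0 x : (0 <= (f \_ D) x)%E by apply: erestrict_ge0.
rewrite !ge0_integralTE//; last by move=> x; apply: le_trans (fgD x).
apply: le_ereal_sup => _ [h hf <-]; exists h => // x.
exact: le_trans (hf x) (fgD x).
Qed.

Section Charts.
Context {R : realType} {n : nat} (M : manifold R n).

Lemma chart_at_cdom (x : M) : cdom (chart_at x) x.
Proof. by case: M x. Qed.

Lemma open_cimg (i : chart M) : open (cimg i).
Proof. by rewrite /cimg; case: M i. Qed.

Lemma chart_coordK (i : chart M) x : cdom i x -> cpar i (coord i x) = x.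
Proof. by case: M i x => //= ? ? ? ? ? ? ? ? ? ? ? ? H *; exact: H. Qed.

Lemma chart_cparK (i : chart M) y : cimg i y -> coord i (cpar i y) = y.
Proof. by case=> x ix <-; rewrite chart_coordK. Qed.

Lemma cpar_cdom (i : chart M) y : cimg i y -> cdom i (cpar i y).
Proof. by case=> x ix <-; rewrite chart_coordK. Qed.

End Charts.

Section Speed.
Context {R : realType} {n : nat} (M : riemannian_manifold R n).
(** [smooth_map_on] is a statement about partial derivatives, whereas the chain rule uses the
    Fréchet differential. Differentiability is assumed here and checked directly for the transition
    maps of both examples. *)
Hypothesis transition_diff : forall (i j : chart M) y,
  (coord i @` (cdom i `&` cdom j)) y -> differentiable (transition i j) y.

Lemma metric_transition (i j : chart M) y :
  (coord i @` (cdom i `&` cdom j)) y ->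
  metric i y = 'J (transition i j) y *m metric j (transition i j y)
               *m ('J (transition i j) y)^T.
Proof. by case: M i j y => //= m g ? ? ? H i j y; exact: H. Qed.

Lemma speed_chart (c : R -> M) t (i : chart M) (v : 'rV[R]_n) :
  (\forall s \near t, cdom i (c s)) -> is_derive t (1 : R) (coord i \o c) v ->
  speed c t = Num.sqrt (inner (metric i (coord i (c t))) v v).
Proof.
move=> ci dv; have cit : cdom i (c t) := nbhs_singleton ci.
rewrite /speed; set j := chart_at (c t).
have cjt : cdom j (c t) := chart_at_cdom (c t).
have nE : \forall s \near t,
    (coord j \o c) s = (transition i j \o (coord i \o c)) s.
  by apply: filterS ci => s cis; rewrite /transition /= chart_coordK.
set y := coord i (c t).
have yij : (coord i @` (cdom i `&` cdom j)) y by exists (c t).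
have dT := transition_diff yij.
have dc : differentiable (coord i \o c) t by apply/derivable1_diffP; case: dv.
have -> : derive1 (coord j \o c) t = v *m 'J (transition i j) y.
  rewrite derive1E (near_eq_derive _ nE) deriveE; last exact: differentiable_comp.
  rewrite diff_comp //= -(deriveE _ dc).
  by have -> := derive_val (is_derive := dv); rewrite -deriveE// deriveEjacobian.
have -> : coord j (c t) = transition i j y by rewrite /transition /= chart_coordK.
rewrite (metric_transition yij) /inner trmx_mul !mulmxA.
by [].
Qed.


(** The infinitesimal form of being 1-Lipschitz: the differential of [F] has norm at most 1 for the
    metric. Continuity of the partial derivatives makes [F] of class C^1 along C^1 curves, so that
    the fundamental theorem of calculus applies. *)
Definition metric_lipschitz (F : M -> R) := forall (i : chart M) y, cimg i y ->
  [/\ differentiable (F \o cpar i) y,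
      forall j, {for y, continuous (partial j (F \o cpar i))} &
      forall v, `|'D_v (F \o cpar i) y| <= Num.sqrt (inner (metric i y) v v)].

(* [speed c] need not be measurable, whence the measurable minorant [G]. *)
Let bounds_increment (c : R -> M) (F : M -> R) (a b : R) :=
  exists G : R -> \bar R, [/\ measurable_fun setT G, forall t, (0 <= G t)%E,
    forall t, a < t < b -> (G t <= (speed c t)%:E)%E,
    forall t, ~~ (a < t < b) -> G t = 0%E &
    (`|F (c b) - F (c a)|%:E <= \int[lebesgue_measure]_t G t)%E].

Let bounds_increment_refl c F a : bounds_increment c F a a.
Proof.
exists (cst 0%E); split => // [t /andP[/lt_trans/[apply]]|]; first by rewrite ltxx.
by rewrite subrr normr0 integral0.
Qed.

Lemma speed_ge0 (c : R -> M) t : 0 <= speed c t.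
Proof. exact: sqrtr_ge0. Qed.

(** The two minorants vanish off disjoint open intervals, so their sum is again a minorant. At the
    breakpoint [b] both are 0, and nothing has to be known about the speed there beyond its sign. *)
Let bounds_increment_cat c F a b d : a <= b -> b <= d ->
  bounds_increment c F a b -> bounds_increment c F b d ->
  bounds_increment c F a d.
Proof.
move=> ab bd [G [mG G0 Gs Gn HG]] [H [mH H0 Hs Hn HH]].
exists (G \+ H)%E; split.
- exact: emeasurable_funD.
- by move=> t; rewrite adde_ge0.
- move=> t /andP[at_ td] /=; case: (ltgtP t b) => tb.
  + rewrite (Hn t) ?adde0; last by rewrite negb_and -leNgt ltW.
    by apply: Gs; rewrite at_.
  + rewrite (Gn t) ?add0e; last by rewrite negb_and orbC -leNgt ltW.
    by apply: Hs; rewrite tb.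
  + rewrite (Gn t) ?(Hn t) ?adde0 ?lee_fin ?speed_ge0 ?tb ?ltxx ?andbF//.
- move=> t; rewrite negb_and -!leNgt => tn; rewrite /= Gn ?Hn ?adde0//.
    by rewrite negb_and -!leNgt; case/orP: tn => [/le_trans->|->]//; rewrite orbT.
  by rewrite negb_and -!leNgt; case/orP: tn => [->|/(le_trans bd)->]//; rewrite orbT.
- rewrite ge0_integralD//; apply: le_trans (leeD HG HH).
  rewrite -EFinD lee_fin; apply: le_trans (ler_normD _ _).
  by rewrite [leRHS](_ : _ = `|F (c d) - F (c a)|)//; congr `|_|; ring.
Qed.

Lemma derive_partial (f : 'rV[R]_n -> R) (y v : 'rV[R]_n) :
  differentiable f y -> 'D_v f y = \sum_j v 0 j * partial j f y.
Proof.
move=> df; rewrite deriveE// {1}[v]row_sum_delta linear_sum/=.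
by apply: eq_bigr => j _; rewrite linearZ /= /partial deriveE.
Qed.

(** Near [t] the curve agrees on [[a, b]] with a C^1 curve [e] read in one chart. The increment of
    [F] is then the integral of the derivative [D] of [F \o cpar i \o e], and [|D|] is at most the
    speed because [F] is 1-Lipschitz. *)
Let bounds_increment_local c F a b t : metric_lipschitz F ->
  C1_on c a b -> a <= t <= b ->
  exists2 eps : R, 0 < eps & forall s s', a <= s -> s <= s' -> s' <= b ->
    t - eps < s -> s' < t + eps -> bounds_increment c F s s'.
Proof.
move=> LF C1c tab; have [i [e [eps [eps0 [de ce] ceP]]]] := C1c t tab.
exists eps => // s s' as_ ss' s'b ts s't.
have [<-|sns'] := eqVneq s s'; first exact: bounds_increment_refl.
have {ss' sns'} ss' : s < s' by rewrite lt_neqAle sns'.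
have inss u : s <= u <= s' -> cdom i (c u) /\ coord i (c u) = e u.
  move=> /andP[su us']; apply: ceP.
    by rewrite (le_trans as_ su) (le_trans us' s'b).
  by rewrite ltr_norml; apply/andP; split; lra.
have ein u : s <= u <= s' -> cimg i (e u).
  by move=> /inss[ciu <-]; exists (c u).
pose H := F \o cpar i; pose psi := H \o e.
pose D := fun u => 'D_(derive1 e u) H (e u).
have ects u : {for u, continuous e}.
  exact/differentiable_continuous/derivable1_diffP.
have dpsi u : s <= u <= s' -> is_derive u (1 : R) psi (D u).
  move=> us; have [dH _ _] := LF _ _ (ein u us).
  have deu : differentiable e u by exact/derivable1_diffP.
  have dp : differentiable psi u by exact: differentiable_comp.
  apply: DeriveDef; first exact: diff_derivable.
  by rewrite deriveE// diff_comp//= /D [RHS]deriveE// derive1E [in RHS]deriveE.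
have cD u : s <= u <= s' -> {for u, continuous D}.
  move=> us; have nb : nbhs (e u) (cimg i) 
    by exact: (open_nbhs_nbhs (conj (@open_cimg _ _ M i) (ein u us))).
  have nei : \forall z \near u, cimg i (e z) := ects u _ nb.
  apply: (@near_eq_continuous _ _
      (fun z => \sum_j (derive1 e z) 0 j * partial j H (e z))).
    by apply: filterS nei => z /= /LF[dH _ _]; rewrite /D derive_partial.
  apply: sum_continuous_at => j; apply: continuousM.
    exact: (continuous_comp (ce u) (@coord_continuous _ _ _ _ _ _)).
  by apply: (continuous_comp (ects u)); have [_ /(_ j)] := LF _ _ (ein u us).
have wcD : {within `[s, s'], continuous D}.
  by apply: continuous_in_subspaceT => u /set_mem /=; rewrite in_itv => /cD.
have ein' u : u \in `]s, s'[ -> s <= u <= s'.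
  by rewrite in_itv => /andP[/ltW-> /ltW->].
have ftc : (\int[lebesgue_measure]_(u in `[s, s']) (D u)%:E =
    (psi s')%:E - (psi s)%:E)%E.
  apply: continuous_FTC2 => //; last first.
    by move=> u /ein' /dpsi dpu; rewrite derive1E derive_val.
  have cpsi u : s <= u <= s' -> {for u, continuous psi}.
    by move=> /dpsi [? _]; exact/differentiable_continuous/derivable1_diffP.
  split; first by move=> u /ein' /dpsi [].
  - by apply: cvg_at_right_filter; apply: cpsi; rewrite lexx ltW.
  - by apply: cvg_at_left_filter; apply: cpsi; rewrite lexx ltW.
have mD : measurable_fun (`[s, s'] : set R) (fun u => (D u)%:E).
  by apply/measurable_EFinP; exact: subspace_continuous_measurable_fun.
have psiE u : s <= u <= s' -> psi u = F (c u).
  by move=> /inss[ciu Eu]; rewrite /psi /H /= -Eu chart_coordK.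
(* The cut-off is to the open interval: there [coord i \o c] agrees with [e] on a neighbourhood of
   each point and has the same derivative, which may fail at the two ends. *)
pose G := ((fun u => `|(D u)%:E|%E) \_ `]s, s'[).
have mG' : measurable_fun (`]s, s'[ : set R) (fun u => `|(D u)%:E|%E).
  by apply: measurableT_comp => //; apply: measurable_funS mD => //.
exists G; split.
- exact/(measurable_restrictT _ _).1.
- by move=> u; rewrite /G /patch; case: ifP.
- move=> u sus; have us : s <= u <= s' by apply: ein'; rewrite in_itv.
  rewrite /G /patch mem_set /= ?in_itv//= lee_fin.
  have nu : \forall z \near u, cdom i (c z) /\ coord i (c z) = e z.
    have : u \in `]s, s'[ by rewrite in_itv.
    move=> /near_in_itvoo.
    by apply: filterS => z /ein' /inss.
  have nc : \forall z \near u, cdom i (c z) by apply: filterS nu => z [].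
  have dcu : is_derive u (1 : R) (coord i \o c) (derive1 e u).
    apply: near_eq_is_derive; last by rewrite derive1E; exact/derivableP.
    by apply: filterS nu => z [].
  rewrite (speed_chart nc dcu); have [_ ->] := inss _ us.
  by have [_ _] := LF _ _ (ein _ us); exact.
- move=> u sus; rewrite /G /patch memNset//= in_itv; exact/negP.
- rewrite /G -integral_mkcond -!psiE ?lexx ?(ltW ss')//.
  rewrite -(integral_itv_bndoo true false mG').
  rewrite -[leLHS]/(`|(psi s' - psi s)%:E|%E) EFinB -ftc.
  exact: le_abse_integral.
Qed.

(** Compactness of [[a, b]] as a supremum argument: the local estimate at the supremum [t] of the
    good endpoints reaches past [t], unless [t = b]. *)
Let bounds_increment_C1 c F a b : metric_lipschitz F -> a <= b ->
  C1_on c a b -> bounds_increment c F a b.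
Proof.
move=> LF ab C1c.
pose E := [set s | a <= s <= b /\ bounds_increment c F a s].
have Ea : E a by split; [rewrite lexx|exact: bounds_increment_refl].
have ubE : ubound E b by move=> s [/andP[]].
have supE : has_sup E by split; [exists a|exists b].
set t := sup E.
have tab : a <= t <= b.
  by apply/andP; split; [exact: (sup_upper_bound supE)|exact: ge_sup supE.1 ubE].
have [eps eps0 loc] := bounds_increment_local LF C1c tab.
have [s [/andP[as_ sb] Is] ts] := sup_adherent eps0 supE.
have st : s <= t by apply: (sup_upper_bound supE); split => //; rewrite as_.
pose s' := Num.min b (t + eps / 2).
have ss' : s <= s' by rewrite le_min sb; lra.
have s'b : s' <= b by rewrite ge_min lexx.
have s't : s' < t + eps by rewrite gt_min; apply/orP; right; lra.
have Is' : bounds_increment c F a s'.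
  by apply: (bounds_increment_cat as_ ss' Is); exact: loc.
have Es' : E s' by split => //; rewrite s'b (le_trans as_ ss').
have : s' <= t by exact: (sup_upper_bound supE).
rewrite ge_min leNgt => /orP[bt|]; last lra.
suff -> : b = s' by [].
by rewrite /s'; apply/esym/min_idPl; lra.
Qed.

Lemma piecewise_C1_le (c : R -> M) a b : piecewise_C1 c a b -> a <= b.
Proof. by elim=> // ? ? ? _ + _ ; exact: le_trans. Qed.

Lemma metric_lipschitz_le_length (c : R -> M) F : metric_lipschitz F ->
  piecewise_C1 c 0 1 -> (`|F (c 1) - F (c 0)|%:E <= curve_length c)%E.
Proof.
move=> LF pc.
have [G [mG G0 Gs Gn HG]] : bounds_increment c F 0 1.
  elim: pc => [a b ab C1c|a b d pab Iab pbd Ibd].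
    exact: bounds_increment_C1.
  exact: (bounds_increment_cat (piecewise_C1_le pab) (piecewise_C1_le pbd) Iab Ibd).
apply: (le_trans HG).
have -> : (\int[lebesgue_measure]_t G t =
    \int[lebesgue_measure]_(t in `[0%R, 1%R]) G t)%E.
  rewrite [RHS]integral_mkcond; apply: eq_integral => t _.
  rewrite /patch; case: ifPn => // /negP t01; apply: Gn.
  apply/negP => /andP[t0 t1]; apply: t01; apply/mem_set.
  by rewrite /= in_itv /= !ltW.
apply: le_integral_nonmeasurable => // t _.
have [/Gs//|/Gn ->] := boolP (0 < t < 1).
by rewrite lee_fin speed_ge0.
Qed.

End Speed.

Section RDist.
Context {R : realType} {n : nat} (M : riemannian_manifold R n).
Implicit Types (c : R -> M) (x y : M).

Lemma curve_length_ge0 c : (0 <= curve_length c)%E.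
Proof. by apply: integral_ge0 => t _; rewrite lee_fin speed_ge0. Qed.

(** Giving the bound [G] together with a primitive [Phi] covers both the constant bounds used for
    segments and the arctangent that appears on the sphere. *)
Lemma curve_length_le c (Phi G : R -> R) :
  (forall t, 0 <= t <= 1 -> speed c t <= G t) ->
  (forall t : R, is_derive t (1 : R) Phi (G t)) -> continuous G ->
  (curve_length c <= (Phi 1 - Phi 0)%:E)%E.
Proof.
move=> cG dPhi cG'.
have cPhi t : {for t, continuous Phi}.
  by have [? _] := dPhi t; exact/differentiable_continuous/derivable1_diffP.
rewrite EFinB -(@continuous_FTC2 _ G) //.
- apply: le_integral_nonmeasurable => t; rewrite /= in_itv /= => t01.
    by rewrite lee_fin speed_ge0.
  by rewrite lee_fin cG.
- exact: continuous_subspaceT.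
- split; first by move=> t _; have [] := dPhi t.
  + by apply: cvg_at_right_filter; exact: cPhi.
  + by apply: cvg_at_left_filter; exact: cPhi.
- by move=> t _; rewrite derive1E derive_val.
Qed.

Lemma rdist_ge0 x y : 0 <= rdist x y.
Proof.
apply: fine_ge0; apply: le_ereal_inf_tmp => _ [c [_ _ _ ->]].
exact: curve_length_ge0.
Qed.

Lemma rdist_le c (B : R) : piecewise_C1 c 0 1 -> (curve_length c <= B%:E)%E ->
  rdist (c 0) (c 1) <= B.
Proof.
move=> pc lB; rewrite -lee_fin /rdist.
set I := ereal_inf _.
have IB : (I <= B%:E)%E by apply: le_trans lB; apply: ereal_inf_lbound; exists c.
have I0 : (0 <= I)%E.
  by apply: le_ereal_inf_tmp => _ [c' [_ _ _ ->]]; exact: curve_length_ge0.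
by rewrite fineK// ge0_fin_numE// (le_lt_trans IB)// ltry.
Qed.

Hypothesis transition_diff : forall (i j : chart M) z,
  (coord i @` (cdom i `&` cdom j)) z -> differentiable (transition i j) z.

(* A curve of finite length is needed because [fine +oo = 0]. *)
Lemma metric_lipschitz_le_rdist c (F : M -> R) : metric_lipschitz F ->
  piecewise_C1 c 0 1 -> (curve_length c < +oo)%E ->
  `|F (c 1) - F (c 0)| <= rdist (c 0) (c 1).
Proof.
move=> LF pc loo; rewrite -lee_fin /rdist.
set I := ereal_inf _.
have Ioo : (I < +oo)%E by apply: le_lt_trans loo; apply: ereal_inf_lbound; exists c.
have I0 : (0 <= I)%E.
  by apply: le_ereal_inf_tmp => _ [c' [_ _ _ ->]]; exact: curve_length_ge0.
rewrite fineK ?ge0_fin_numE//; apply: le_ereal_inf_tmp => _ [c' [pc' <- <- ->]].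
exact: metric_lipschitz_le_length.
Qed.

Lemma is_derive_affine (y v : 'rV[R]_n) (t : R) :
  is_derive t (1 : R) (fun s : R => y + s *: v) v.
Proof.
have dl : is_derive t (1 : R) ( *:%R^~ v) v.
  have dl : is_diff t ( *:%R^~ v) ( *:%R^~ v) by exact: is_diff_scalel.
  apply: DeriveDef; first by apply: diff_derivable.
  by rewrite deriveE// diff_val scale1r.
have := is_deriveD (is_derive_cst y t (1 : R)) dl.
by rewrite add0r.
Qed.

Lemma C1_curve_affine (y v : 'rV[R]_n) : C1_curve (fun s : R => y + s *: v).
Proof.
split=> [s|]; first by have [] := is_derive_affine y v s.
rewrite (_ : derive1 _ = cst v); first exact: cst_continuous.
by apply/funext => s; rewrite derive1E; have [_] := is_derive_affine y v s.
Qed.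

Lemma C1_on_affine (i : chart M) (y v : 'rV[R]_n) c a b :
  (forall s, a <= s <= b ->
    cimg i (y + s *: v) /\ c s = cpar i (y + s *: v)) ->
  C1_on c a b.
Proof.
move=> H t _; exists i, (fun s => y + s *: v), 1.
split => //; first exact: C1_curve_affine.
by move=> s /H[yi ->] _; split; [exact: cpar_cdom|exact: chart_cparK].
Qed.

Lemma speed_affine (i : chart M) (y v : 'rV[R]_n) c (t : R) :
  cimg i (y + t *: v) -> (\forall s \near t, c s = cpar i (y + s *: v)) ->
  speed c t = Num.sqrt (inner (metric i (y + t *: v)) v v).
Proof.
move=> yi nc.
have ca : {for t, continuous (fun s : R => y + s *: v)}.
  apply/differentiable_continuous/derivable1_diffP.
  by have [] := is_derive_affine y v t.
have nb : nbhs (y + t *: v) (cimg i).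
  by apply: open_nbhs_nbhs; split; [exact: open_cimg|].
have ni : \forall s \near t, cimg i (y + s *: v) := ca _ nb.
have nd : \forall s \near t, cdom i (c s).
  by apply: filterS2 ni nc => s si ->; exact: cpar_cdom.
have nE : \forall s \near t, y + s *: v = (coord i \o c) s.
  by apply: filterS2 ni nc => s si /= ->; rewrite chart_cparK.
rewrite (speed_chart transition_diff nd
  (near_eq_is_derive nE (is_derive_affine y v t))).
by have /= <- := nbhs_singleton nE.
Qed.

Lemma segment_length_le (i : chart M) (y v : 'rV[R]_n) (Phi G : R -> R) :
  (forall t, 0 <= t <= 1 -> cimg i (y + t *: v)) ->
  (forall t, 0 <= t <= 1 ->
    Num.sqrt (inner (metric i (y + t *: v)) v v) <= G t) ->
  (forall t : R, is_derive t (1 : R) Phi (G t)) -> continuous G ->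
  let c : R -> M := fun t => cpar i (y + t *: v) in
  piecewise_C1 c 0 1 /\ (curve_length c <= (Phi 1 - Phi 0)%:E)%E.
Proof.
move=> yi vG dPhi cG c; split.
  apply: pw_C1; first exact: ler01.
  by apply: (C1_on_affine (i := i)) => s s01; split => //; exact: yi.
apply: curve_length_le dPhi cG => t t01.
have nc : \forall s \near t, c s = cpar i (y + s *: v) by near=> s.
by rewrite (speed_affine (yi t t01) nc) vG.
Unshelve. all: by end_near. Qed.

Lemma rdist_segment (i : chart M) (y v : 'rV[R]_n) (B : R) :
  (forall t, 0 <= t <= 1 -> cimg i (y + t *: v)) ->
  (forall t, 0 <= t <= 1 ->
    Num.sqrt (inner (metric i (y + t *: v)) v v) <= B) ->
  rdist (cpar i y : M) (cpar i (y + v)) <= B.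
Proof.
move=> yi vB.
have dB (t : R) : is_derive t (1 : R) (fun s : R => s * B) B.
  have -> : (fun s : R => s * B) = B \*: (id : R -> R).
    by apply/funext => s; rewrite /= mulrC.
  by rewrite -[X in is_derive _ _ _ X]mulr1; exact: is_deriveZ.
have [pc lc] := segment_length_le yi vB dB (@cst_continuous _ _ B).
have := rdist_le pc (le_trans lc (lexx _)).
by rewrite scale0r addr0 scale1r mul1r mul0r subr0.
Qed.

End RDist.

(** * Curvature of the metrics phi^-2 I *)

Section PointwiseDerive.
Context {R : realType} {V : normedModType R}.
Implicit Types (f g : V -> R) (x v : V).

Lemma is_derive_add f g x v (df dg : R) : is_derive x v f df ->
  is_derive x v g dg -> is_derive x v (fun y => f y + g y) (df + dg).
Proof. exact: is_deriveD. Qed.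

Lemma is_derive_mul f g x v (df dg : R) : is_derive x v f df ->
  is_derive x v g dg ->
  is_derive x v (fun y => f y * g y) (f x * dg + g x * df).
Proof. exact: is_deriveM. Qed.

Lemma is_derive_inv f x v (df : R) : f x != 0 -> is_derive x v f df ->
  is_derive x v (fun y => (f y)^-1) (- (df / f x ^+ 2)).
Proof.
move=> fx0 [d1 <-]; apply: DeriveDef; first exact: derivableV.
by rewrite deriveV// /GRing.scale /= mulNr mulrC.
Qed.

Lemma is_derive_cmul (c : R) f x v (df : R) : is_derive x v f df ->
  is_derive x v (fun y => c * f y) (c * df).
Proof. exact: is_deriveZ. Qed.

Lemma is_derive_sumf m (F : 'I_m -> V -> R) x v (dF : 'I_m -> R) :
  (forall i, is_derive x v (F i) (dF i)) ->
  is_derive x v (fun y => \sum_i F i y) (\sum_i dF i).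
Proof.
move=> dFi; rewrite (_ : (fun y => _) = \sum_i F i); first exact: is_derive_sum.
by apply/funext => y; rewrite fct_sumE.
Qed.

End PointwiseDerive.

Section Gram.
Context {R : realType} {n : nat}.
Implicit Types u v : 'rV[R]_n.

Definition dot u v : R := \sum_i u 0 i * v 0 i.

Lemma inner_scalar (c : R) u v : inner c%:M u v = c * dot u v.
Proof.
by rewrite /inner mul_mx_scalar -scalemxAl !mxE; congr (_ * _);
  apply: eq_bigr => i _; rewrite mxE.
Qed.

Lemma dot_ge0 u : 0 <= dot u u.
Proof. by apply: sumr_ge0 => i _; rewrite -expr2 sqr_ge0. Qed.

Lemma dot_gt0 u : u != 0 -> 0 < dot u u.
Proof.
move=> u0; rewrite lt_neqAle dot_ge0 andbT eq_sym; apply: contraNneq u0.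
move=> /psumr_eq0P uu0; apply/eqP/rowP => i; rewrite mxE.
have /eqP : u 0 i * u 0 i = 0 by apply: uu0 => // j _; rewrite -expr2 sqr_ge0.
by rewrite mulf_eq0 orbb => /eqP.
Qed.

Lemma lagrange_identity u v : dot u u * dot v v - dot u v ^+ 2 =
  2^-1 * \sum_i \sum_j (u 0 i * v 0 j - u 0 j * v 0 i) ^+ 2.
Proof.
rewrite (eq_bigr (fun i => \sum_j (u 0 i * u 0 i * (v 0 j * v 0 j)
    + v 0 i * v 0 i * (u 0 j * u 0 j)
    - 2 * (u 0 i * v 0 i * (u 0 j * v 0 j))))); last first.
  by move=> i _; apply: eq_bigr => j _; ring.
under eq_bigr do rewrite sumrB big_split/= -!mulr_sumr.
by rewrite sumrB big_split/= -mulr_sumr -!mulr_suml -/(dot u v) -/(dot u u)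
  -/(dot v v); field.
Qed.

Lemma dot_sqr_le u v : dot u v ^+ 2 <= dot u u * dot v v.
Proof.
rewrite -subr_ge0 lagrange_identity mulr_ge0// sumr_ge0// => i _.
by rewrite sumr_ge0// => j _; rewrite sqr_ge0.
Qed.

(** If all minors vanish, then [v 0 i *: u - u 0 i *: v = 0] for every [i]. Independence then forces
    [v = 0], and a zero vector is not part of an independent pair. *)
Lemma row_free_minors u v : row_free (col_mx u v) ->
  0 < \sum_i \sum_j (u 0 i * v 0 j - u 0 j * v 0 i) ^+ 2.
Proof.
move=> fuv; rewrite lt_neqAle sumr_ge0 ?andbT; last first.
  by move=> i _; rewrite sumr_ge0// => j _; rewrite sqr_ge0.
rewrite eq_sym; apply/eqP => /psumr_eq0P m0.
have m_eq0 i j : u 0 i * v 0 j = u 0 j * v 0 i.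
  have /psumr_eq0P mi0 : \sum_j (u 0 i * v 0 j - u 0 j * v 0 i) ^+ 2 = 0.
    by apply: m0 => // k _; rewrite sumr_ge0// => l _; rewrite sqr_ge0.
  have /eqP : (u 0 i * v 0 j - u 0 j * v 0 i) ^+ 2 = 0.
    by apply: mi0 => // k _; rewrite sqr_ge0.
  by rewrite sqrf_eq0 subr_eq0 => /eqP.
have free c d : c *: u + d *: v = 0 -> c = 0.
  move=> cd; have /eqP : row_mx (c%:M : 'M[R]_1) (d%:M : 'M[R]_1) *m col_mx u v = 0.
    by rewrite mul_row_col !mul_scalar_mx.
  rewrite mulmx_free_eq0// => /eqP /(congr1 lsubmx).
  by rewrite row_mxKl => /matrixP /(_ 0 0); rewrite !mxE eqxx mulr1n.
have v0 : v = 0.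
  apply/rowP => i; rewrite mxE; apply: (free _ (- u 0 i)).
  by apply/rowP => j; rewrite !mxE mulNr m_eq0; ring.
have : (1 : R) = 0.
  apply: (free _ 0); rewrite scale0r addr0 scale1r.
  apply/rowP => i; rewrite mxE.
  have : row_mx (0%:M : 'M[R]_1) (1%:M : 'M[R]_1) *m col_mx u v = 0.
    by rewrite mul_row_col !mul_scalar_mx v0 scaler0 addr0 scale0r.
  move=> /eqP; rewrite mulmx_free_eq0// => /eqP /(congr1 rsubmx).
  rewrite row_mxKr => /matrixP /(_ 0 0); rewrite !mxE eqxx mulr1n => /eqP.
  by rewrite oner_eq0.
by apply/eqP; rewrite oner_eq0.
Qed.

End Gram.

Section ConformalCurvature.
Context {R : realType} {n : nat} (b : R) (a : 'I_n -> R).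
Hypotheses (b_gt0 : 0 < b) (a_ge0 : forall i, 0 <= a i).
Implicit Types (x u v : 'rV[R]_n).

Definition conf_factor x : R := b + \sum_i a i * (x 0 i * x 0 i) / 2.

Definition conf_metric x : 'M[R]_n := ((conf_factor x ^+ 2)^-1)%:M.

Lemma conf_factor_ge x : b <= conf_factor x.
Proof.
rewrite lerDl; apply: sumr_ge0 => i _.
by rewrite divr_ge0// mulr_ge0// -expr2 sqr_ge0.
Qed.

Lemma conf_factor_gt0 x : 0 < conf_factor x.
Proof. exact: lt_le_trans (conf_factor_ge x). Qed.

Let phi0 x : conf_factor x != 0.
Proof. by rewrite gt_eqF// conf_factor_gt0. Qed.

(** Kronecker's delta as a scalar, which turns the tensor identities below into polynomial
    identities. *)
Let d (i j : 'I_n) : R := (i == j)%:R.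

Let dC i j : d i j = d j i.
Proof. by rewrite /d eq_sym. Qed.

Let sum_d (F : 'I_n -> R) i : \sum_k F k * d i k = F i.
Proof.
rewrite (bigD1 i)//= big1 ?addr0 /d ?eqxx ?mulr1// => k ki.
by rewrite eq_sym (negbTE ki) mulr0.
Qed.

Let delta_coord i j : (delta_mx 0 i : 'rV[R]_n) 0 j = d i j.
Proof. by rewrite mxE eqxx /= /d eq_sym. Qed.

Lemma is_derive_conf_factor x v :
  is_derive x v conf_factor (\sum_i a i * x 0 i * v 0 i).
Proof.
have h i : is_derive x v (fun y : 'rV[R]_n => a i * (y 0 i * y 0 i) / 2)
    (a i * x 0 i * v 0 i).
  have := is_derive_cmul (a i / 2)
    (is_derive_mul (is_derive_coord i x v) (is_derive_coord i x v)).
  rewrite (_ : a i / 2 * _ = a i * x 0 i * v 0 i); last by field.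
  rewrite (_ : (fun y : 'rV[R]_n => a i / 2 * _) =
    fun y : 'rV[R]_n => a i * (y 0 i * y 0 i) / 2)//.
  by apply/funext => y; field.
by have := is_derive_add (is_derive_cst b x v) (is_derive_sumf h); rewrite add0r.
Qed.

Let dphi x i : is_derive x (delta_mx 0 i) conf_factor (a i * x 0 i).
Proof.
have := is_derive_conf_factor x (delta_mx 0 i).
by under eq_bigr do rewrite delta_coord; rewrite sum_d.
Qed.

(** With [psi = - ln phi] the metric is [e^(2 psi) I], and [f i] is the [i]-th partial derivative of
    [psi]. [Gamma] below is the usual formula for the Christoffel symbols of such a metric, and [S]
    is the squared Euclidean norm of the gradient of [psi]. *)
Let f i x : R := - (a i * x 0 i) / conf_factor x.

Let df x i j :
  is_derive x (delta_mx 0 i) (f j) (f i x * f j x - a i / conf_factor x * d i j).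
Proof.
have h1 := is_derive_cmul (- a j) (is_derive_coord j x (delta_mx 0 i)).
have h2 := is_derive_mul h1 (is_derive_inv (phi0 x) (dphi x i)).
rewrite delta_coord in h2.
rewrite (_ : f j = fun y => - a j * y 0 j * (conf_factor y)^-1); last first.
  by apply/funext => y; rewrite /f !mulNr.
apply: is_derive_eq h2 _; rewrite /f.
rewrite (_ : (conf_factor x)^-1 * (- a j * d i j) = - (a i / conf_factor x * d i j)).
  by field.
rewrite /d; case: eqP => [->|_]; last by rewrite !mulr0 oppr0.
by rewrite mulNr mulrN mulrAC mulrC !mulr1.
Qed.

Let metricE x j l : conf_metric x j l = (conf_factor x ^+ 2)^-1 * d j l.
Proof. by rewrite !mxE mulr_natr. Qed.

Let partial_metric x i j l : partial i (fun y => conf_metric y j l) x =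
  2 * f i x / conf_factor x ^+ 2 * d j l.
Proof.
have h1 := is_derive_mul (dphi x i) (dphi x i).
have phi20 : conf_factor x * conf_factor x != 0 by rewrite mulf_neq0.
have h2 := is_derive_cmul (d j l) (is_derive_inv (f := fun y => conf_factor y * conf_factor y) phi20 h1).
rewrite (_ : (fun y => conf_metric y j l) =
    fun y => d j l * (conf_factor y * conf_factor y)^-1); last first.
  by apply/funext => y; rewrite metricE expr2 mulrC.
have [_] := h2; rewrite /partial => ->; rewrite /f.
by field.
Qed.

Let Gamma l i j x : R := f i x * d l j + f j x * d l i - f l x * d i j.

Let christoffelE l i j : christoffel conf_metric l i j = Gamma l i j.
Proof.
apply/funext => x; rewrite /christoffel /Gamma.
rewrite (eq_bigr (fun m => 2 * (f i x * d j m + f j x * d i m - f m x * d i j) * d l m)).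
  by rewrite (sum_d (fun m => 2 * _)) (dC j l) (dC i l) mulrA mulVf ?mul1r// pnatr_eq0.
move=> m _; rewrite !partial_metric /conf_metric invmx_scalar invrK mxE -mulr_natr.
by rewrite -/(d l m); field.
Qed.

Let S x : R := \sum_m f m x ^+ 2.

Let sum_Gamma (X : 'I_n -> R) j k x : \sum_m Gamma m j k x * X m =
  f j x * X k + f k x * X j - d j k * \sum_m f m x * X m.
Proof.
rewrite -(sum_d X k) -(sum_d X j) !mulr_sumr -big_split/= -sumrB.
by apply: eq_bigr => m _; rewrite /Gamma (dC m j) (dC m k); ring.
Qed.

Let sum_f_Gamma l i x : \sum_m f m x * Gamma l i m x = S x * d l i.
Proof.
rewrite (eq_bigr (fun m => f i x * (f m x * d l m) + f m x ^+ 2 * d l i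
    - f l x * (f m x * d i m))); last by move=> m _; rewrite /Gamma; ring.
rewrite sumrB big_split/= -!mulr_sumr !sum_d -mulr_suml -/(S x); ring.
Qed.

Let partial_Gamma l i j k x : partial i (Gamma l j k) x =
  (f i x * f j x - a i / conf_factor x * d i j) * d l k +
  (f i x * f k x - a i / conf_factor x * d i k) * d l j -
  (f i x * f l x - a i / conf_factor x * d i l) * d j k.
Proof.
have h1 := is_derive_cmul (d l k) (df x i j).
have h2 := is_derive_cmul (d l j) (df x i k).
have h3 := is_derive_cmul (- d j k) (df x i l).
have [_] := is_derive_add (is_derive_add h1 h2) h3.
rewrite /partial (_ : (fun y => _) = Gamma l j k); last first.
  by apply/funext => y; rewrite /Gamma; ring.
by move=> ->; ring.
Qed.

(** The products [f i * f j] coming from the derivatives of [Gamma] cancel against the quadratic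
    terms. What remains involves only [S] and the Hessian of [phi], which is diagonal with entries
    [a i]; so the curvature operator is diagonal on the coordinate planes. *)
Let riemann_coefE l i j k x : riemann_coef conf_metric l i j k x =
  (S x - a i / conf_factor x - a j / conf_factor x) *
  (d i k * d j l - d j k * d i l).
Proof.
rewrite /riemann_coef !christoffelE !partial_Gamma.
rewrite (eq_bigr (fun m => Gamma m j k x * Gamma l i m x
    - Gamma m i k x * Gamma l j m x)); last by move=> m _; rewrite !christoffelE.
rewrite sumrB !sum_Gamma !sum_f_Gamma /Gamma.
rewrite ?(dC j i) ?(dC k i) ?(dC l i) ?(dC k j) ?(dC l j) ?(dC l k).
(* Where [d i j] is nonzero the two indices coincide; [ring] needs this as an additional
   equation. *)
have hd : a j / conf_factor x * d i j = a i / conf_factor x * d i j.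
  by rewrite /d; case: eqP => [->//|_]; rewrite !mulr0.
ring: hd.
Qed.

Let inner_riemannE x u v :
  inner (conf_metric x) (riemann conf_metric x u v v) u =
  (conf_factor x ^+ 2)^-1 * (2^-1 * \sum_i \sum_j
    (a i / conf_factor x + a j / conf_factor x - S x) *
    (u 0 i * v 0 j - u 0 j * v 0 i) ^+ 2).
Proof.
pose K i j := S x - a i / conf_factor x - a j / conf_factor x.
rewrite inner_scalar; congr (_ * _); rewrite /dot.
have -> : \sum_l (riemann conf_metric x u v v) 0 l * u 0 l =
    \sum_i \sum_j u 0 i * v 0 j * (K i j * (v 0 i * u 0 j - v 0 j * u 0 i)).
  under eq_bigr do rewrite mxE mulr_suml.
  rewrite exchange_big; apply: eq_bigr => i _ /=.
  under eq_bigr do rewrite mulr_suml.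
  rewrite exchange_big; apply: eq_bigr => j _ /=.
  transitivity (\sum_l (u 0 i * v 0 j * K i j * v 0 i * (u 0 l * d j l)
      - u 0 i * v 0 j * K i j * v 0 j * (u 0 l * d i l))).
    apply: eq_bigr => l _; rewrite mulr_suml.
    rewrite (eq_bigr (fun k => u 0 i * v 0 j * K i j * u 0 l * d j l * (v 0 k * d i k)
        - u 0 i * v 0 j * K i j * u 0 l * d i l * (v 0 k * d j k))).
      by rewrite sumrB -!mulr_sumr !sum_d; ring.
    by move=> k _; rewrite riemann_coefE /K; ring.
  by rewrite sumrB -!mulr_sumr !sum_d; ring.
(* [K] is symmetric, so adding to the double sum its copy with [i] and [j] exchanged turns each
   product into the square of a minor. *)
apply: (@mulfI _ 2); first by rewrite pnatr_eq0.
rewrite mulrA mulfV ?pnatr_eq0// mul1r mulr_natl mulr2n {1}exchange_big/=.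
rewrite -big_split; apply: eq_bigr => i _ /=; rewrite -big_split.
by apply: eq_bigr => j _ /=; rewrite /K; ring.
Qed.

(* The curvature of the span of [u] and [v] is the average of the curvatures
   of the coordinate planes, weighted by the squared minors of [u, v]. *)
Lemma conf_sectional_curvature_ge (kappa : R) x u v :
  (forall i j, i != j ->
    kappa <= conf_factor x * (a i + a j) - \sum_k (a k * x 0 k) ^+ 2) ->
  row_free (col_mx u v) -> kappa <= sectional_curvature conf_metric x u v.
Proof.
move=> Hk /row_free_minors m_gt0; rewrite /sectional_curvature inner_riemannE.
have p0 := conf_factor_gt0 x; have p20 := exprn_gt0 2 p0.
rewrite {1 2 3}/conf_metric !inner_scalar.
set P := conf_factor x in Hk p0 p20 *.
rewrite (_ : (P ^+ 2)^-1 * dot u u * _ - _ =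
  (P ^+ 2)^-1 ^+ 2 * (dot u u * dot v v - dot u v ^+ 2)); last by ring.
rewrite lagrange_identity; set Q := \sum_i _ in m_gt0 *.
rewrite ler_pdivlMr; last by rewrite !mulr_gt0// ?exprn_gt0 ?invr_gt0.
rewrite (_ : kappa * _ = (P ^+ 2)^-1 * (2^-1 * ((P ^+ 2)^-1 * kappa * Q))); last by ring.
rewrite ler_pM2l ?invr_gt0// ler_pM2l ?invr_gt0// mulr_sumr.
apply: ler_sum => i _; rewrite mulr_sumr; apply: ler_sum => j _.
have [->|ij] := eqVneq i j; first by rewrite subrr expr0n !mulr0.
rewrite ler_wpM2r ?sqr_ge0// mulrC ler_pdivrMr//.
apply: le_trans (Hk i j ij) _; rewrite /S.
rewrite [leRHS](_ : _ = P * (a i + a j) - \sum_k (P * f k x) ^+ 2).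
  rewrite lerD2l lerN2; apply: ler_sum => k _.
  by rewrite /f -/P mulrC divfK ?gt_eqF// sqrrN.
under [in RHS]eq_bigr do rewrite exprMn.
by rewrite -mulr_sumr; field; rewrite gt_eqF.
Qed.

End ConformalCurvature.

(** * Topology of subtypes *)

Section Subtypes.

Lemma set_val_continuous (X : topologicalType) (A : set X) :
  continuous (set_val : A -> X).
Proof. exact: initial_continuous. Qed.

Lemma set_type_hausdorff (X : topologicalType) (A : set X) :
  hausdorff_space X -> hausdorff_space A.
Proof.
move=> hX p q pq; apply: val_inj; apply: hX => B C pB qC.
have [z [Bz Cz]] := pq _ _ (set_val_continuous pB) (set_val_continuous qC).
by exists (set_val z).
Qed.

Lemma continuous_at_set_val (T X : topologicalType) (A : set X) (f : T -> A) t :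
  {for t, continuous (set_val \o f)} -> {for t, continuous f}.
Proof.
move=> cf U [?/= [[W oW <-]]] /= Wsfz /filterS; apply; apply: cf.
exact: open_nbhs_nbhs.
Qed.

(** A compact set is totally bounded: for each [n] finitely many balls of radius [1 / (n + 1)] cover
    [K], and the traces on [A] of the interiors of all these balls form a countable base. *)
Lemma set_type_second_countable (R : realType) (X : normedModType R)
    (A K : set X) : compact K -> A `<=` K -> @second_countable A.
Proof.
move=> cK AK; have npos n : (0 : R) < n.+1%:R^-1 by [].
pose f n (z : X) : set X := (ball z (PosNum (npos n))%:num)°.
have h n : finite_subset_cover [set: X] (f n) K.
  move: cK; rewrite compact_cover; apply.
  - by move=> z _; rewrite /f; exact: open_interior.
  - by move=> z _; exists z => //; rewrite /f /interior; exact: nbhsx_ballx.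
pose h' n := cid (iffLR (exists2P _ _) (h n)).
pose h'' n := projT1 (h' n).
pose B := \bigcup_n ((fun z => (set_val : A -> X) @^-1` f n z) @` [set` h'' n]).
exists B; [|split].
- apply: bigcup_countable => // n _; apply: finite_set_countable.
  exact/finite_image/finite_fset.
- by move=> _ [m _ [z _ <-]]; exists (f m z) => //; exact: open_interior.
- move=> x V /= [_ [[W oW <-] Wx] WV].
  have /nbhs_ballP [_/posnumP[eps] ballW] : nbhs (set_val x) W.
    exact: open_nbhs_nbhs.
  have [//|N] := @ltr_add_invr R 0%R (eps%:num/2) _; rewrite add0r => deleps.
  have Kx : K (set_val x) by apply: AK; exact: set_valP.
  have [w wh fx] : exists2 w : X, w \in h'' N & f N w (set_val x).
    by have [_ /(_ _ Kx) [w ? ?]] := projT2 (h' N); exists w.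
  exists (set_val @^-1` f N w); first by split => //; exists N => //; exists w.
  move=> z /= bz; apply: WV; apply: ballW.
  rewrite [_%:num]splitr; apply: (@ball_triangle _ _ w).
    by apply: (le_ball (ltW deleps)); apply/ball_sym; apply: interior_subset.
  by apply: (le_ball (ltW deleps)); apply: interior_subset.
Qed.

Lemma star_connected (R : realType) (V : normedModType R) (S : set V) p :
  (forall x t, S x -> 0 <= t <= 1 -> S (p + t *: (x - p))) -> connected S.
Proof.
move=> star; pose seg x := (fun t : R => p + t *: (x - p)) @` `[0, 1].
have -> : S = \bigcup_(x in S) seg x.
  apply/seteqP; split=> [x Sx|_ [x Sx [t /= + <-]]]; last first.
    by rewrite in_itv => /(star x t Sx).
  exists x => //; exists 1; first by rewrite /= in_itv /= ler01 lexx.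
  by rewrite scale1r addrC subrK.
apply: bigcup_connected.
  exists p => x _; exists 0; first by rewrite /= in_itv /= ler01 lexx.
  by rewrite scale0r addr0.
move=> x _; apply: connected_continuous_connected.
  exact: segment_connected.
apply: continuous_subspaceT => t.
by apply: cvgD; [exact: cvg_cst|apply: cvgZr_tmp; exact: cvg_id].
Qed.

End Subtypes.

(** * Boxes with a conformally flat metric *)

(** The first-order expansion of [f] at [x] is also one of [g], and the continuous linear part of
    such an expansion is unique. *)
Lemma near_eq_diff (R : numFieldType) (V W : normedModType R) (f g : V -> W) x :
  (\forall z \near x, f z = g z) -> differentiable f x ->
  differentiable g x /\ 'd g x = 'd f x :> (V -> W).
Proof.
move=> fg dfx; have fgx := nbhs_singleton fg.
have dg : g \o shift x = cst (g x) + 'd f x +o_ 0 id.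
  apply/eqaddoP => e e0.
  have /eqaddoP /(_ e e0) := diff_locally dfx.
  have : \forall h \near (0 : V), f (h + x) = g (h + x).
    by move: fg; rewrite (near_shift 0) subr0.
  by apply: filterS2 => h fgh; rewrite -fgx !fctE /= fgh.
have E := diff_unique (diff_continuous dfx) dg.
split; last exact: E.
by apply/diff_locallyP; rewrite E; split; [exact: diff_continuous|].
Qed.

Section ConformalMetric.
Context {R : realType} {n : nat} (b : R) (a : 'I_n -> R).
Hypotheses (b_gt0 : 0 < b) (a_ge0 : forall i, 0 <= a i).
Implicit Types (y u v : 'rV[R]_n).
Let g := conf_metric b a.

Lemma smooth_conf_metric U i j : open U -> smooth_on U (fun y => g y i j).
Proof.
move=> oU k; have Cphi : Ck_on k U (conf_factor b a).
  apply: (Ck_onD oU (Ck_on_cst k U b)); apply: (Ck_on_sum oU) => l.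
  apply: (eq_Ck_on oU _ (Ck_onM oU (Ck_on_cst k U (a l / 2))
    (Ck_onM oU (Ck_on_coord k U l) (Ck_on_coord k U l)))) => x _ /=.
  by rewrite mulrAC.
have phi20 x : U x -> conf_factor b a x * conf_factor b a x != 0.
  by rewrite mulf_neq0// gt_eqF// conf_factor_gt0.
apply: (eq_Ck_on oU _ (Ck_onM oU (Ck_onV oU phi20 (Ck_onM oU Cphi Cphi))
  (Ck_on_cst k U (i == j)%:R))) => x _ /=.
by rewrite /g /conf_metric !mxE mulr_natr expr2.
Qed.

Lemma conf_metric_sym y : (g y)^T = g y.
Proof. exact: tr_scalar_mx. Qed.

Lemma conf_metric_pos y u : u != 0 -> 0 < inner (g y) u u.
Proof.
move=> u0; rewrite inner_scalar mulr_gt0// ?dot_gt0//.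
by rewrite invr_gt0 exprn_gt0// conf_factor_gt0.
Qed.

Lemma sqrt_conf_metric y u :
  Num.sqrt (inner (g y) u u) = Num.sqrt (dot u u) / conf_factor b a y.
Proof.
rewrite inner_scalar mulrC sqrtrM ?dot_ge0// sqrtrV; last exact: sqr_ge0.
by rewrite sqrtr_sqr ger0_norm// ltW// conf_factor_gt0.
Qed.

End ConformalMetric.

Section Box.
Context {R : realType} {n : nat} (w : 'I_n -> R).
Hypothesis w_gt0 : forall i, 0 < w i.

Definition box : set 'rV[R]_n := [set x | forall i, `|x 0 i| < w i].

Lemma open_box : open box.
Proof.
rewrite openE => x bx; change (nbhs (x : 'rV[R]_n) box).
rewrite -[box]/([set z : 'rV[R]_n | forall i, `|z 0 i| < w i]).
apply: (@filter_forall _ _ (fun i => [set z : 'rV[R]_n | `|z 0 i| < w i]) _ (nbhs_filter x)) => i.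
have : x 0 i \in `](- w i), (w i)[ by rewrite in_itv /= -ltr_norml bx.
move=> /near_in_itvoo /(@coord_continuous _ _ _ 0 i x) nx.
apply: (@filterS _ _ (nbhs_filter x) _ _ _ nx) => z /=.
by rewrite in_itv /= -ltr_norml.
Qed.

Lemma box0 : box 0.
Proof. by move=> i; rewrite mxE normr0. Qed.

Lemma box_convex x y t : box x -> box y -> 0 <= t <= 1 -> box (x + t *: (y - x)).
Proof.
move=> bx by_ /andP[t0 t1] i; move: (bx i) (by_ i); rewrite !mxE !ltr_norml.
move: (x 0 i) (y 0 i) => p q /andP[? ?] /andP[? ?].
have [pq|/ltW qp] := leP p q.
  have ? : 0 <= t * (q - p) by rewrite mulr_ge0// subr_ge0.
  have ? : t * (q - p) <= q - p by rewrite ler_piMl// subr_ge0.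
  by apply/andP; split; lra.
have ? : 0 <= t * (p - q) by rewrite mulr_ge0// subr_ge0.
have ? : t * (p - q) <= p - q by rewrite ler_piMl// subr_ge0.
by apply/andP; split; lra.
Qed.

Lemma connected_box : connected box.
Proof.
by apply: (@star_connected _ _ _ 0) => x t bx t01; exact: box_convex box0 bx t01.
Qed.

Definition box_pt : box := SigSub (mem_set box0).

Definition to_box (x : 'rV[R]_n) : box := insubd box_pt x.

Lemma to_boxE x : box x -> set_val (to_box x) = x.
Proof. by move=> bx; exact: (insubdK box_pt (mem_set bx)). Qed.

Lemma set_val_to_box (x : box) : to_box (set_val x) = x.
Proof. exact: valKd. Qed.

Lemma near_to_box x : box x -> \forall z \near x, z = set_val (to_box z).
Proof.
move=> bx; apply: filterS (open_nbhs_nbhs (conj open_box bx)) => z.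
by move=> /to_boxE.
Qed.

Lemma to_box_continuous x : box x -> {for x, continuous to_box}.
Proof.
move=> bx; apply: continuous_at_set_val.
by apply: near_eq_continuous (near_to_box bx) _; exact: cvg_id.
Qed.

Lemma box_second_countable : @second_countable box.
Proof.
have cK : compact [set v : 'rV[R]_n | forall i, `[- w i, w i]%classic (v ord0 i)].
  apply: (@rV_compact _ _ (fun i => `[- w i, w i]%classic)).
  by move=> i; exact: segment_compact.
apply: (set_type_second_countable cK).
move=> x bx i; rewrite /= in_itv /= -ler_norml ltW//; exact: bx.
Qed.

Lemma box_connected : connected [set: box].
Proof.
have -> : [set: box] = to_box @` box.
  apply/seteqP; split=> // x _; exists (set_val x); first exact: set_valP.
  exact: set_val_to_box.
apply: connected_continuous_connected connected_box _.
by apply: continuous_in_subspaceT => x /set_mem; exact: to_box_continuous.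
Qed.

Lemma box_chart_image (A : set box) : A = setT -> set_val @` A = box.
Proof.
move=> ->; apply/seteqP; split=> [_ [x _ <-]|x bx]; first exact: set_valP.
by exists (to_box x) => //; exact: to_boxE.
Qed.

Definition box_manifold : manifold R n.
Proof.
refine (@Manifold R n (box : topologicalType) unit (fun=> setT)
  (fun=> set_val) (fun=> to_box) (fun=> tt) _ _ _ _ _ _ _ _ _ _).
- by apply: set_type_hausdorff; exact: norm_hausdorff.
- exact: box_second_countable.
- exact: box_connected.
- by [].
- by move=> _; exact: openT.
- by move=> _; rewrite box_chart_image//; exact: open_box.
- by move=> _ x _; exact: set_val_to_box.
- by move=> _ x _; exact: set_val_continuous.
- by move=> _ y; rewrite box_chart_image// => /to_box_continuous.
- move=> _ _ i k; rewrite box_chart_image ?setIid//.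
  apply: (eq_Ck_on open_box _ (Ck_on_coord k box i)) => x bx /=.
  by rewrite to_boxE.
Defined.

Lemma cimg_box (i : chart box_manifold) : cimg i = box.
Proof. exact: box_chart_image. Qed.

Lemma box_diff (f : 'rV[R]_n -> 'rV[R]_n) (x : 'rV[R]_n) : box x ->
  (forall z, box z -> f z = z) -> differentiable f x /\ 'd f x = id :> (_ -> _).
Proof.
move=> bx fE.
have nE : \forall z \near x, id z = f z.
  by apply: filterS (open_nbhs_nbhs (conj open_box bx)) => z /fE ->.
have did : is_diff x id id by exact: is_diff_id.
have [? ->] := near_eq_diff nE (ex_diff (is_diff_def := did)).
by split=> //; exact: diff_val.
Qed.

Lemma box_transitionE (i j : chart box_manifold) x :
  box x -> transition i j x = x.
Proof. exact: to_boxE. Qed.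

Lemma box_transition_diff (i j : chart box_manifold) y :
  (coord i @` (cdom i `&` cdom j)) y -> differentiable (transition i j) y.
Proof.
rewrite box_chart_image ?setIid// => by_.
by have [] := box_diff by_ (@box_transitionE i j).
Qed.

Section BoxMetric.
Variables (b : R) (a : 'I_n -> R).
Hypotheses (b_gt0 : 0 < b) (a_ge0 : forall i, 0 <= a i).

Definition box_riemannian : riemannian_manifold R n.
Proof.
refine (@RiemannianManifold R n box_manifold (fun=> conf_metric b a) _ _ _ _).
- by move=> i k l; rewrite cimg_box; apply: smooth_conf_metric => //; exact: open_box.
- by move=> i y _; exact: conf_metric_sym.
- by move=> i y _; exact: conf_metric_pos.
- move=> i j y; rewrite box_chart_image ?setIid// => by_.
  have [_ dE] := box_diff by_ (@box_transitionE i j).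
  have -> /= : 'J (transition i j) y = 1%:M.
    by apply/matrixP => k l; rewrite !mxE dE !mxE eqxx eq_sym.
  rewrite trmx1 mulmx1 mul1mx; congr conf_metric.
  exact/esym/(box_transitionE i j).
Defined.

Let M := box_riemannian.

Lemma box_sec_bounded_below kappa :
  (forall x, box x -> forall i j, i != j ->
    kappa <= conf_factor b a x * (a i + a j) - \sum_k (a k * x 0 k) ^+ 2) ->
  sec_bounded_below M kappa.
Proof.
move=> H i y; rewrite cimg_box => by_ u v.
by apply: conf_sectional_curvature_ge => //; exact: H.
Qed.

Let segment_in_box (x y : M) t : 0 <= t <= 1 ->
  box (set_val x + t *: (set_val y - set_val x)).
Proof. by move=> ?; apply: box_convex => //; exact: set_valP. Qed.

Let metric_le (x v : 'rV[R]_n) :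
  Num.sqrt (inner (conf_metric b a x) v v) <= Num.sqrt (dot v v) / b.
Proof.
rewrite sqrt_conf_metric// ler_wpM2l ?sqrtr_ge0// lef_pV2 ?posrE//.
  exact: conf_factor_ge.
exact: conf_factor_gt0.
Qed.

Lemma box_rdist_le (x y : M) : rdist x y <=
  Num.sqrt (dot (set_val y - set_val x) (set_val y - set_val x)) / b.
Proof.
have := @rdist_segment _ _ M box_transition_diff tt (set_val x)
  (set_val y - set_val x) _ _ (fun t _ => metric_le _ _).
rewrite [set_val x + (_ - _)]addrC subrK ![cpar _ _]set_val_to_box; apply.
by move=> t t01; rewrite cimg_box; exact: segment_in_box.
Qed.

(** The function [c * z 0 i] is 1-Lipschitz for the metric as soon as [c <= phi^-1] on the box. The
    straight segment provides the curve of finite length. *)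
Lemma box_rdist_ge (c : R) i (x y : M) : 0 <= c ->
  (forall z, box z -> c * conf_factor b a z <= 1) ->
  c * `|set_val y 0 i - set_val x 0 i| <= rdist x y.
Proof.
move=> c0 Hc; pose F (z : M) := c * set_val z 0 i.
have FE z : box z -> F (to_box z) = c * z 0 i by move=> /to_boxE /= E; rewrite /F E.
pose L (z : 'rV[R]_n) := c * z 0 i.
have nF z : box z -> \forall t \near z, L t = (F \o to_box) t.
  move=> bz; apply: filterS (open_nbhs_nbhs (conj open_box bz)) => t /FE /=.
  by move=> ->.
have dF z v : box z -> is_derive z v (F \o to_box) (c * v 0 i).
  by move=> bz; apply: near_eq_is_derive (nF z bz) _;
    apply: is_derive_cmul; exact: is_derive_coord.
have LF : metric_lipschitz F.
  move=> j z; rewrite cimg_box => bz; split.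
  - have dc : differentiable L z.
      by apply: differentiableZ; exact: differentiable_coord.
    by have [] := near_eq_diff (nF z bz) dc.
  - move=> k; apply: (@near_eq_continuous _ _ (cst (c * (delta_mx 0 k : 'rV[R]_n) 0 i))).
      apply: filterS (open_nbhs_nbhs (conj open_box bz)) => t bt.
      by rewrite /partial; have [_ ->] := dF t (delta_mx 0 k) bt.
    exact: cst_continuous.
  - move=> v; have [_ ->] := dF z v bz; rewrite sqrt_conf_metric//.
    rewrite ler_pdivlMr ?conf_factor_gt0// normrM (ger0_norm c0) mulrAC.
    apply: (@le_trans _ _ `|v 0 i|).
      by rewrite -[leRHS]mul1r ler_wpM2r// Hc.
    rewrite -sqrtr_sqr ler_sqrt ?dot_ge0// /dot (bigD1 i)//= -expr2 lerDl.
    by apply: sumr_ge0 => k _; rewrite -expr2 sqr_ge0.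
set v := set_val y - set_val x.
have dPhi (t : R) : is_derive t (1 : R) (fun s : R => Num.sqrt (dot v v) / b * s)
    (Num.sqrt (dot v v) / b).
  by rewrite -[X in is_derive _ _ _ X]mulr1; apply: is_derive_cmul; exact: is_derive_id.
have inbox t : 0 <= t <= 1 -> cimg (tt : chart M) (set_val x + t *: v).
  by move=> t01; rewrite cimg_box; exact: segment_in_box.
have [pc lc] := segment_length_le box_transition_diff (M := M) inbox
  (fun t _ => metric_le _ _) dPhi (@cst_continuous _ _ _).
have := metric_lipschitz_le_rdist (M := M) box_transition_diff LF pc (le_lt_trans lc (ltry _)).
rewrite scale0r addr0 scale1r /v [set_val x + (_ - _)]addrC subrK ![cpar _ _]set_val_to_box.
by rewrite /F -mulrBr normrM ger0_norm.
Qed.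

End BoxMetric.

End Box.

(** * The sphere in stereographic charts *)

Section Inversion.
Context {R : realType} {n : nat}.
Implicit Types x v : 'rV[R]_n.

Definition sqn x := dot x x.

Definition inversion x := (sqn x)^-1 *: x.

Lemma sqnZ (c : R) x : sqn (c *: x) = c ^+ 2 * sqn x.
Proof.
by rewrite /sqn /dot mulr_sumr; apply: eq_bigr => i _; rewrite !mxE; ring.
Qed.

Lemma sqn_eq0 x : (sqn x == 0) = (x == 0).
Proof.
apply/idP/eqP => [|->]; last first.
  by rewrite /sqn /dot big1// => i _; rewrite mxE mul0r.
by apply: contraTeq => x0; rewrite gt_eqF// dot_gt0.
Qed.

Lemma sqn1_gt0 x : 0 < 1 + sqn x.
Proof. by rewrite ltr_pwDl// dot_ge0. Qed.

Lemma Ck_on_sqn k U : open U -> Ck_on k U sqn.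
Proof.
move=> oU; apply: Ck_on_sum => // i.
by apply: Ck_onM => //; exact: Ck_on_coord.
Qed.

Lemma is_derive_sqn x v : is_derive x v sqn (2 * dot x v).
Proof.
rewrite /dot mulr_sumr; apply: is_derive_sumf => i.
have := is_derive_mul (is_derive_coord i x v) (is_derive_coord i x v).
by rewrite (_ : _ + _ = 2 * (x 0 i * v 0 i)); last by ring.
Qed.

Lemma differentiable_sqn x : differentiable sqn x.
Proof.
rewrite (_ : sqn = \sum_i (fun z : 'rV[R]_n => z 0 i * z 0 i)); last first.
  by apply/funext => z; rewrite fct_sumE.
by apply: differentiable_sum => i; apply: differentiableM;
  exact: differentiable_coord.
Qed.

Lemma continuous_sqn : continuous sqn.
Proof. by move=> x; exact/differentiable_continuous/differentiable_sqn. Qed.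

Lemma open_neq0 : open [set x : 'rV[R]_n | x != 0].
Proof.
rewrite (_ : [set x | _] = ~` [set 0]).
  apply: closed_openC; apply: accessible_closed_set1.
  by apply: hausdorff_accessible; exact: norm_hausdorff.
by apply/seteqP; split=> x /= /eqP.
Qed.

Lemma smooth_inversion : smooth_map_on [set x | x != 0] inversion.
Proof.
move=> i k.
have q0 x : [set x : 'rV[R]_n | x != 0] x -> sqn x != 0 by rewrite /= sqn_eq0.
apply: (eq_Ck_on open_neq0 _ (Ck_onM open_neq0
  (Ck_onV open_neq0 q0 (Ck_on_sqn k open_neq0)) (Ck_on_coord k _ i))).
by move=> x _; rewrite /inversion mxE.
Qed.

Lemma differentiable_inversion x : x != 0 -> differentiable inversion x.
Proof.
move=> x0; rewrite (_ : inversion =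
    \sum_i (fun z : 'rV[R]_n => ((sqn z)^-1 * z 0 i) *: delta_mx 0 i)); last first.
  apply/funext => z; rewrite fct_sumE /inversion {2}[z]row_sum_delta scaler_sumr.
  by apply: eq_bigr => i _; rewrite scalerA.
apply: differentiable_sum => i; apply: differentiableZl.
apply: differentiableM; last exact: differentiable_coord.
by apply: differentiableV; [exact: differentiable_sqn|rewrite sqn_eq0].
Qed.

Lemma jacobian_inversion x : x != 0 ->
  'J inversion x = (sqn x)^-1%:M - (2 / sqn x ^+ 2) *: (x^T *m x).
Proof.
move=> x0; have q0 : sqn x != 0 by rewrite sqn_eq0.
have di := differentiable_inversion x0.
apply/matrixP => k l; rewrite mxE -(deriveE _ di).
rewrite derive_mx; last exact: diff_derivable.
rewrite mxE.
have h := is_derive_mul (is_derive_inv q0 (is_derive_sqn x (delta_mx 0 k)))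
  (is_derive_coord l x (delta_mx 0 k)).
rewrite (_ : (fun z => inversion z 0 l) = fun z => (sqn z)^-1 * z 0 l); last first.
  by apply/funext => z; rewrite mxE.
have [_ ->] := h.
have -> : dot x (delta_mx 0 k) = x 0 k.
  rewrite /dot (bigD1 k)//= big1 ?addr0; first by rewrite mxE !eqxx mulr1.
  by move=> m mk; rewrite mxE (negbTE mk) andbF mulr0.
rewrite !mxE big_ord1 !mxE eqxx /= -mulr_natr [l == k]eq_sym.
by field.
Qed.

(** As [P *m P = sqn x *: P], the Jacobian is [(sqn x)^-1] times the reflection in the hyperplane
    orthogonal to [x]; in particular the inversion is conformal. *)
Lemma jacobian_inversion_conformal x : x != 0 ->
  'J inversion x *m ('J inversion x)^T = (sqn x ^- 2)%:M.
Proof.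
move=> x0; have q0 : sqn x != 0 by rewrite sqn_eq0.
rewrite jacobian_inversion//; set P := x^T *m x; set q := sqn x in q0 *.
have PT : P^T = P by rewrite /P trmx_mul trmxK.
have -> : (q^-1%:M - (2 / q ^+ 2) *: P)^T = q^-1%:M - (2 / q ^+ 2) *: P.
  by rewrite linearB/= tr_scalar_mx linearZ/= PT.
have PP : P *m P = q *: P.
  rewrite /P mulmxA -[_ *m x *m _]mulmxA (_ : x *m x^T = q%:M).
    by rewrite mul_mx_scalar -scalemxAl.
  apply/matrixP => i j; rewrite !ord1 !mxE eqxx mulr1n.
  by apply: eq_bigr => k _; rewrite mxE.
rewrite mulmxBl !mulmxBr -!scalar_mxM !mul_scalar_mx mul_mx_scalar.
rewrite -!scalemxAl -!scalemxAr PP !scalerA.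
clear PT; move: PP; generalize P => P' _.
apply/matrixP => i j; rewrite !mxE.
by case: (i == j); rewrite ?mulr1n ?mulr0n; field.
Qed.

End Inversion.

Section Sphere.
Context {R : realType} {n : nat} (i0 : 'I_n).
Implicit Types (x y v : 'rV[R]_n) (s : bool).

Definition unit_sphere : set ('rV[R]_n * R) := [set z | sqn z.1 + z.2 ^+ 2 = 1].

(** The sphere without the pole of last coordinate [- (-1) ^+ s]; thus [s = true] removes [(0, 1)].
    The chart is the stereographic projection from the removed pole, with the opposite pole at the
    origin. *)
Definition sphere_cdom s : set unit_sphere :=
  [set z | 1 + (-1) ^+ s * (set_val z).2 != 0].

Definition sphere_coord s (z : unit_sphere) : 'rV[R]_n :=
  (1 + (-1) ^+ s * (set_val z).2)^-1 *: (set_val z).1.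

Definition stereo s x : 'rV[R]_n * R :=
  ((2 / (1 + sqn x)) *: x, (-1) ^+ s * ((1 - sqn x) / (1 + sqn x))).

Let sgn_sqr s : (-1) ^+ s * (-1) ^+ s = 1 :> R.
Proof. by case: s; rewrite /= ?expr1 ?expr0; ring. Qed.

Let q1_neq0 x : 1 + sqn x != 0.
Proof. by rewrite gt_eqF// sqn1_gt0. Qed.

Lemma stereo_unit_sphere s x : unit_sphere (stereo s x).
Proof.
rewrite /unit_sphere /stereo /= sqnZ !exprMn sqrr_sign mul1r.
by field; exact: q1_neq0.
Qed.

Definition sphere_cpar s x : unit_sphere := SigSub (mem_set (stereo_unit_sphere s x)).

Let set_val_cpar s x : set_val (sphere_cpar s x) = stereo s x.
Proof. by []. Qed.

Let stereo_denom s s' x :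
  1 + (-1) ^+ s' * (stereo s x).2 =
  (if s == s' then 2 else 2 * sqn x) / (1 + sqn x).
Proof.
rewrite /stereo /= mulrA; have := q1_neq0 x.
by case: s s' => [] [] /=; rewrite ?expr1 ?expr0 => q0; field.
Qed.

Lemma sphere_cpar_cdom s x : sphere_cdom s (sphere_cpar s x).
Proof.
rewrite /sphere_cdom /mkset set_val_cpar stereo_denom eqxx.
by rewrite mulf_neq0// invr_neq0.
Qed.

Lemma sphere_transition s s' x : sphere_coord s' (sphere_cpar s x) =
  if s == s' then x else inversion x.
Proof.
rewrite /sphere_coord set_val_cpar stereo_denom /stereo /= scalerA.
have q0 := q1_neq0 x; case: ifP => _.
  by rewrite [X in X *: _](_ : _ = 1) ?scale1r//; field.
(* Both sides are multiples of [x], so they also agree at the origin. Hence the transition map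
   equals [inversion] as a function and not only on the overlap. *)
have [->|x0] := eqVneq x 0; first by rewrite /inversion !scaler0.
by congr (_ *: _); field; rewrite q0 sqn_eq0 x0.
Qed.

Lemma sphere_coordK s z : sphere_cdom s z -> sphere_cpar s (sphere_coord s z) = z.
Proof.
rewrite /sphere_cdom /= => d0; apply: val_inj.
have := set_valP z; rewrite /unit_sphere /= => zS.
rewrite -[LHS]/(stereo s (sphere_coord s z)) /stereo.
set q := sqn _.
have e2 := sgn_sqr s.
have qE : q = (1 - (-1) ^+ s * (set_val z).2) / (1 + (-1) ^+ s * (set_val z).2).
  rewrite /q sqnZ; have -> : sqn (set_val z).1 = 1 - (set_val z).2 ^+ 2.
    by rewrite -zS addrK.
  set t := (set_val z).2 in d0 *; set e := (-1) ^+ s in d0 e2 *.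
  have -> : 1 - t ^+ 2 = (1 - e * t) * (1 + e * t) by ring: e2.
  by field.
have q1E : 1 + q = 2 / (1 + (-1) ^+ s * (set_val z).2) by rewrite qE; field.
rewrite q1E [RHS]surjective_pairing; congr pair.
  rewrite /sphere_coord scalerA [X in X *: _](_ : _ = 1) ?scale1r//.
  by field.
rewrite qE; set t := (set_val z).2 in d0 *; set e := (-1) ^+ s in d0 e2 *.
transitivity (e * e * t); last by rewrite e2 mul1r.
by field.
Qed.

Lemma sphere_cdom_image s (A : set unit_sphere) : A = sphere_cdom s ->
  sphere_coord s @` A = setT.
Proof.
move=> ->; apply/seteqP; split=> // x _; exists (sphere_cpar s x).
  exact: sphere_cpar_cdom.
by rewrite sphere_transition eqxx.
Qed.

Lemma sphere_overlap_image s s' : s != s' ->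
  sphere_coord s @` (sphere_cdom s `&` sphere_cdom s') = [set x | x != 0].
Proof.
move=> ss'; apply/seteqP; split=> [_ [z [zs zs'] <-]|x /= x0].
  rewrite /= -sqn_eq0; apply: contra_neq zs' => q0.
  rewrite -(sphere_coordK zs) set_val_cpar.
  by rewrite stereo_denom (negbTE ss') q0 mulr0 mul0r.
exists (sphere_cpar s x); last by rewrite sphere_transition eqxx.
split; first exact: sphere_cpar_cdom.
rewrite /sphere_cdom /mkset set_val_cpar stereo_denom (negbTE ss').
by rewrite mulf_neq0 ?invr_neq0// mulf_neq0 ?sqn_eq0.
Qed.

Lemma sphere_cpar_continuous s : continuous (sphere_cpar s).
Proof.
move=> x; apply: continuous_at_set_val; rewrite -[set_val \o _]/(stereo s).
have c1 : {for x, continuous (fun z : 'rV[R]_n => (1 + sqn z)^-1)}.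
  apply: continuousV; first exact: q1_neq0.
  by apply: continuousD; [exact: cst_continuous|exact: continuous_sqn].
have h1 : {for x, continuous (fun z : 'rV[R]_n => (2 / (1 + sqn z)) *: z)}.
  have h0 : {for x, continuous (fun z : 'rV[R]_n => 2 / (1 + sqn z))}.
    by apply: continuousM; [exact: cst_continuous|exact: c1].
  exact: (cvgZ h0 cvg_id).
have h2 : {for x, continuous
    (fun z : 'rV[R]_n => (-1) ^+ s * ((1 - sqn z) / (1 + sqn z)))}.
  apply: continuousM; first exact: cst_continuous.
  apply: continuousM; last exact: c1.
  by apply: continuousB; [exact: cst_continuous|exact: continuous_sqn].
exact: cvg_pair h1 h2.
Qed.

Lemma stereo_coord_continuous s (z : 'rV[R]_n * R) :
  1 + (-1) ^+ s * z.2 != 0 ->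
  {for z, continuous (fun p : 'rV[R]_n * R => (1 + (-1) ^+ s * p.2)^-1 *: p.1)}.
Proof.
move=> d0; apply: cvgZ; last exact: cvg_fst.
apply: cvgV => //; apply: cvgD; first exact: cvg_cst.
by apply: cvgM; [exact: cvg_cst|exact: cvg_snd].
Qed.

Lemma sphere_coord_continuous s z : sphere_cdom s z ->
  {for z, continuous (sphere_coord s)}.
Proof.
move=> d0.
exact: (continuous_comp (@set_val_continuous _ _ z) (stereo_coord_continuous d0)).
Qed.

Lemma denom_continuous s :
  continuous (fun p : 'rV[R]_n * R => 1 + (-1) ^+ s * p.2).
Proof.
move=> z; apply: cvgD; first exact: cvg_cst.
by apply: cvgM; [exact: cvg_cst|exact: cvg_snd].
Qed.

Lemma open_sphere_cdom s : open (sphere_cdom s).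
Proof.
exists [set p : 'rV[R]_n * R | 1 + (-1) ^+ s * p.2 != 0] => //.
have := open_comp (fun p _ => @denom_continuous s p) (@open_neq R 0).
exact.
Qed.

Lemma sphere_cover z s : ~ sphere_cdom s z -> sphere_cdom (~~ s) z.
Proof.
rewrite /sphere_cdom /=; move: (set_val z).2 => t /negP; rewrite negbK => /eqP.
by case: s => /=; rewrite ?expr1 ?expr0 => h; apply/eqP => h'; lra.
Qed.

Lemma sphere_hausdorff : hausdorff_space unit_sphere.
Proof. by apply: set_type_hausdorff; exact: norm_hausdorff. Qed.

Lemma sphere_second_countable : @second_countable unit_sphere.
Proof.
have cI : compact [set v : 'rV[R]_n | forall i, `[(-1 : R), 1]%classic (v ord0 i)].
  apply: (@rV_compact _ _ (fun=> `[(-1 : R), 1]%classic)).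
  by move=> i; exact: segment_compact.
have cK := compact_setX cI (@segment_compact R (-1) 1).
apply: (set_type_second_countable cK) => z zS.
have q_ge0 : 0 <= sqn z.1 by exact: dot_ge0.
have t_ge0 := sqr_ge0 z.2.
have sq_le1 (t : R) : t ^+ 2 <= 1 -> t \in `[-1, 1].
  by move=> t1; rewrite in_itv /= -ler_norml -(ler_pXn2r (n := 2)) ?nnegrE// expr1n real_normK ?num_real.
split=> [i|] /=; apply: sq_le1; last by rewrite -zS lerDr.
rewrite -zS; apply: (@le_trans _ _ (sqn z.1)); last by rewrite lerDl.
rewrite /sqn /dot (bigD1 i)//= -expr2 lerDl.
by apply: sumr_ge0 => k _; rewrite -expr2 sqr_ge0.
Qed.

(** A point of the equator, which has the same coordinates in both charts. Its existence is where
    [n > 0] enters: for [n = 0] the sphere consists of two points and is not connected. *)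
Let e0 : 'rV[R]_n := delta_mx 0 i0.

Lemma sqn_e0 : sqn e0 = 1.
Proof.
rewrite /sqn /dot (bigD1 i0)//= big1 ?addr0; first by rewrite mxE !eqxx mulr1.
by move=> m mk; rewrite mxE (negbTE mk) andbF mulr0.
Qed.

Lemma sphere_equator s s' : sphere_cpar s e0 = sphere_cpar s' e0.
Proof.
apply: val_inj; rewrite -[LHS]/(stereo s e0) -[RHS]/(stereo s' e0).
by rewrite /stereo sqn_e0 subrr mul0r !mulr0.
Qed.

Lemma sphere_connected : connected [set: unit_sphere].
Proof.
have -> : [set: unit_sphere] =
    (sphere_cpar true @` setT) `|` (sphere_cpar false @` setT).
  apply/seteqP; split=> // z _; have [zt|zt] := pselect (sphere_cdom true z).
    by left; exists (sphere_coord true z) => //; exact: sphere_coordK.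
  right; exists (sphere_coord false z) => //; apply: sphere_coordK.
  exact: sphere_cover zt.
have cT : connected [set: 'rV[R]_n] by exact: (@star_connected _ _ _ 0).
apply: connectedU.
- exists (sphere_cpar true e0); split; first by exists e0.
  by exists e0 => //; exact: sphere_equator.
- by apply: connected_continuous_connected => //;
    apply: continuous_subspaceT; exact: sphere_cpar_continuous.
- by apply: connected_continuous_connected => //;
    apply: continuous_subspaceT; exact: sphere_cpar_continuous.
Qed.

Definition sphere_chart_at (z : unit_sphere) : bool :=
  ~~ `[< sphere_cdom false z >].

Lemma sphere_chart_atP z : sphere_cdom (sphere_chart_at z) z.
Proof.
rewrite /sphere_chart_at; case: asboolP => //=.
by move=> /sphere_cover.
Qed.

Definition sphere_manifold : manifold R n.
Proof.
refine (@Manifold R n (unit_sphere : topologicalType) bool sphere_cdom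
  sphere_coord sphere_cpar sphere_chart_at _ _ _ _ _ _ _ _ _ _).
- exact: sphere_hausdorff.
- exact: sphere_second_countable.
- exact: sphere_connected.
- exact: sphere_chart_atP.
- exact: open_sphere_cdom.
- by move=> s; rewrite sphere_cdom_image//; exact: openT.
- exact: sphere_coordK.
- exact: sphere_coord_continuous.
- by move=> s y _; exact: sphere_cpar_continuous.
- move=> s s'; have [<-|ss'] := eqVneq s s'.
    rewrite setIid sphere_cdom_image// => i k.
    apply: (eq_Ck_on openT _ (Ck_on_coord k setT i)) => x _ /=.
    by rewrite sphere_transition eqxx.
  rewrite (sphere_overlap_image ss') => i k.
  apply: (eq_Ck_on open_neq0 _ (smooth_inversion i k)) => x _ /=.
  by rewrite sphere_transition (negbTE ss').
Defined.

End Sphere.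

(** * Round spheres *)

Section RoundSphere.
Context {R : realType} {n : nat} (i0 : 'I_n) (rho : R).
Hypothesis rho_gt0 : 0 < rho.
Implicit Types (x y v : 'rV[R]_n) (s : bool).
Let S := sphere_manifold (R := R) i0.
(** These constants give [phi = (1 + |x|^2) / (2 rho)]. The metric [4 rho^2 (1 + |x|^2)^-2 I] is the
    round metric of radius [rho] in stereographic coordinates; the carrier remains the unit
    sphere. *)
Let b : R := (2 * rho)^-1.
Let a (_ : 'I_n) : R := rho^-1.

Let b_gt0 : 0 < b.
Proof. by rewrite invr_gt0 mulr_gt0. Qed.

Let a_ge0 i : 0 <= a i.
Proof. by rewrite invr_ge0 ltW. Qed.

Let rho0 : rho != 0.
Proof. exact: lt0r_neq0. Qed.

Let factorE x : conf_factor b a x = (1 + sqn x) / (2 * rho).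
Proof.
rewrite /conf_factor [RHS]mulrDl mul1r; congr (_ + _).
by rewrite /sqn /dot mulr_suml; apply: eq_bigr => i _; rewrite /a; field.
Qed.

Lemma cimg_sphere (s : chart S) : cimg s = setT.
Proof. exact: sphere_cdom_image. Qed.

Lemma sphere_same_transition (s : chart S) : transition s s = id.
Proof. by apply/funext => x; rewrite /transition /= sphere_transition eqxx. Qed.

Lemma sphere_opp_transition (s s' : chart S) :
  (s : bool) != s' -> transition s s' = inversion.
Proof.
by move=> ss'; apply/funext => x; rewrite /transition /= sphere_transition (negbTE ss').
Qed.

Lemma sphere_overlap (s s' : chart S) : (s : bool) != s' ->
  coord s @` (cdom s `&` cdom s') = [set x | x != 0].
Proof. exact: sphere_overlap_image. Qed.

Lemma sphere_transition_diff (s s' : chart S) y :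
  (coord s @` (cdom s `&` cdom s')) y -> differentiable (transition s s') y.
Proof.
have [->|ss'] := eqVneq (s : bool) s'.
  by move=> _; rewrite sphere_same_transition; exact: ex_diff.
rewrite sphere_opp_transition// sphere_overlap// => y0.
exact: differentiable_inversion.
Qed.

Definition sphere_riemannian : riemannian_manifold R n.
Proof.
refine (@RiemannianManifold R n S (fun=> conf_metric b a) _ _ _ _).
- by move=> s k l; rewrite cimg_sphere; apply: smooth_conf_metric => //; exact: openT.
- by move=> s y _; exact: conf_metric_sym.
- by move=> s y _; exact: conf_metric_pos.
- move=> s s' y; have [->|ss'] := eqVneq (s : bool) s'.
    move=> _ J; rewrite /J {J} sphere_same_transition.
    have -> : 'J id y = 1%:M.
      apply/matrixP => k l; rewrite !mxE.
      have did : is_diff y id id by exact: is_diff_id.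
      by rewrite diff_val !mxE eqxx eq_sym.
    by rewrite trmx1 mulmx1 mul1mx.
  rewrite sphere_overlap// => y0 J.
  rewrite /J {J}.
  (* Since [phi (inversion y) = phi y / |y|^2], the metric at the image point gains a factor
     [|y|^4], which cancels the [|y|^-4] of the Jacobian. *)
  rewrite sphere_opp_transition// /conf_metric mul_mx_scalar -scalemxAl.
  rewrite jacobian_inversion_conformal// scale_scalar_mx; congr _%:M.
  have q0 : sqn y != 0 by rewrite sqn_eq0.
  have q1 : 1 + sqn y != 0 by rewrite gt_eqF// sqn1_gt0.
  rewrite !factorE /inversion sqnZ; field.
  by rewrite rho0 q0 addrC q1.
Defined.

Let M := sphere_riemannian.

Lemma sphere_sec_bounded_below kappa : kappa <= rho ^- 2 ->
  sec_bounded_below M kappa.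
Proof.
move=> kr s y _ u v; apply: conf_sectional_curvature_ge => // i j _.
apply: (le_trans kr); rewrite factorE /a.
rewrite (eq_bigr (fun k => rho ^- 2 * (y 0 k * y 0 k))); last by move=> k _; field.
by rewrite -mulr_sumr -/(dot y y) -/(sqn y) le_eqVlt; apply/orP; left; apply/eqP; field.
Qed.

Lemma sphere_metric_le x v :
  Num.sqrt (inner (conf_metric b a x) v v) <= Num.sqrt (sqn v) / b.
Proof.
rewrite sqrt_conf_metric// ler_wpM2l ?sqrtr_ge0// lef_pV2 ?posrE//.
  exact: conf_factor_ge.
exact: conf_factor_gt0.
Qed.

Lemma sphere_rdist_le s x y :
  rdist (sphere_cpar s x : M) (sphere_cpar s y) <= Num.sqrt (sqn (y - x)) / b.
Proof.
have := @rdist_segment _ _ M sphere_transition_diff s x (y - x) _ _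
  (fun t _ => sphere_metric_le _ _).
by rewrite [x + (_ - _)]addrC subrK; apply=> t _; rewrite cimg_sphere.
Qed.

(** The segment from [x] to the origin runs along a great circle and has length [2 rho atan |x|],
    where the arctangent stays below [pi / 2]. The exact length is needed, as a constant bound on
    the speed grows with [|x|]. Strictness excludes the distance [r] even when [pi * rho = r]. *)
Lemma sphere_rdist_lt s x : rdist (sphere_cpar s x : M) (sphere_cpar s 0) < pi * rho.
Proof.
set q := Num.sqrt (sqn x).
pose h (t : R) := (1 - t) * q.
pose G t := 2 * rho * q / (1 + h t ^+ 2).
pose Phi t := - (2 * rho * atan (h t)).
have dh (t : R) : is_derive t (1 : R) h (- q).
  have h1 := is_derive_add (is_derive_cst (1 : R) t (1 : R))
    (is_derive_cmul (-1) (is_derive_id t (1 : R))).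
  have := is_derive_cmul q h1.
  rewrite (_ : q * _ = - q); last by ring.
  rewrite (_ : (fun y : R => _) = h)//; apply/funext => u; rewrite /h /cst; ring.
have h0 t : 1 + h t ^+ 2 != 0 by rewrite gt_eqF// ltr_pwDl// sqr_ge0.
have dPhi (t : R) : is_derive t (1 : R) Phi (G t).
  have h1 := is_derive1_comp (is_derive1_atan (h t)) (dh t).
  have := is_derive_cmul (- (2 * rho)) h1.
  rewrite (_ : - (2 * rho) * _ = G t); last by rewrite /G; field.
  rewrite (_ : (fun y : R => _) = Phi)//; apply/funext => u.
  by rewrite /Phi /= mulNr.
have ch : continuous h.
  by move=> t; have [? _] := dh t; exact/differentiable_continuous/derivable1_diffP.
have cG : continuous G.
  move=> t; have dG := is_derive_cmul (2 * rho * q)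
    (is_derive_inv (f := fun u => cst 1 u + h u * h u) (h0 t)
      (is_derive_add (is_derive_cst (1 : R) t (1 : R)) (is_derive_mul (dh t) (dh t)))).
  have [d _] := dG.
  exact/(@differentiable_continuous _ _ _ t G)/derivable1_diffP.
have vG t : 0 <= t <= 1 ->
    Num.sqrt (inner (metric (s : chart M) (x + t *: (0 - x))) (0 - x) (0 - x)) <= G t.
  move=> _; rewrite sub0r /= sqrt_conf_metric// factorE.
  have -> : dot (- x) (- x) = sqn x.
    by rewrite -[dot _ _]/(sqn (- x)) -scaleN1r sqnZ sqrrN expr1n mul1r.
  have -> : sqn (x + t *: - x) = h t ^+ 2.
    have -> : x + t *: - x = (1 - t) *: x by rewrite scalerN scalerBl scale1r.
    by rewrite sqnZ /h exprMn /q sqr_sqrtr// dot_ge0.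
  by rewrite -/q /G le_eqVlt; apply/orP; left; apply/eqP; field; rewrite h0.
have inU t : 0 <= t <= 1 -> cimg (s : chart M) (x + t *: (0 - x)).
  by move=> _; rewrite cimg_sphere.
have [pc lc] := segment_length_le (M := M) sphere_transition_diff inU vG dPhi cG.
have := rdist_le pc lc.
rewrite scale0r addr0 scale1r [x + _]addrC subrK => le; apply: (le_lt_trans le).
have -> : Phi 1 = 0 by rewrite /Phi /h subrr mul0r atan0 mulr0 oppr0.
have -> : Phi 0 = - (2 * rho * atan q) by rewrite /Phi /h subr0 mul1r.
rewrite sub0r opprK (_ : pi * rho = 2 * rho * (pi / 2)); last by field.
by rewrite ltr_pM2l ?mulr_gt0//; exact: atan_ltpi2.
Qed.

Let w : 'rV[R]_n := delta_mx 0 i0.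

(** Two segments, each in a chart around one of the endpoints, are joined at the equatorial point
    [w], where the charts agree. This is the curve of finite length required by
    [metric_lipschitz_le_rdist]. *)
Lemma sphere_finite_path (z z' : M) : exists c : R -> M,
  [/\ piecewise_C1 c 0 1, c 0 = z, c 1 = z' & (curve_length c < +oo)%E].
Proof.
pose s := sphere_chart_at z; pose s' := sphere_chart_at z'.
pose x := sphere_coord s z; pose y := sphere_coord s' z'.
have xz : sphere_cpar s x = z by exact/sphere_coordK/sphere_chart_atP.
have yz : sphere_cpar s' y = z' by exact/sphere_coordK/sphere_chart_atP.
(* Each segment is run through in half the time: [x + t *: v] goes from [x] to [w] on [[0, 1/2]],
   and [y' + t *: v'] from [w] to [y] on [[1/2, 1]]. *)
pose v := 2 *: (w - x); pose v' := 2 *: (y - w); pose y' := 2 *: w - y.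
pose c (t : R) : M := if t <= 2^-1 then sphere_cpar s (x + t *: v)
  else sphere_cpar s' (y' + t *: v').
have c2 : x + 2^-1 *: v = w.
  by rewrite /v scalerA mulVf// scale1r addrC subrK.
have c2' : y' + 2^-1 *: v' = w.
  rewrite /v' /y' scalerA mulVf// scale1r scaler_nat mulr2n.
  by rewrite addrA subrK addrK.
have cE t : 2^-1 <= t -> c t = sphere_cpar s' (y' + t *: v').
  rewrite le_eqVlt => /orP[/eqP <-|t2]; last by rewrite /c leNgt t2.
  by rewrite /c lexx c2 c2' (sphere_equator i0 s s').
exists c; split.
- apply: (@pw_cat _ _ _ c 0 2^-1 1).
    apply: pw_C1; first by rewrite invr_ge0.
    apply: (C1_on_affine (i := (s : chart M)) (y := x) (v := v)) => t /andP[_ t2].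
    by rewrite cimg_sphere /c t2.
  apply: pw_C1; first by lra.
  apply: (C1_on_affine (i := (s' : chart M)) (y := y') (v := v')) => t /andP[t2 _].
  by rewrite cimg_sphere cE.
- by rewrite /c invr_ge0 ler0n scale0r addr0.
- rewrite cE; last by lra.
  rewrite (_ : y' + 1 *: v' = y)//.
  by apply/rowP => k; rewrite !mxE; ring.
(* At the corner [t = 1/2] the curve need not be differentiable and [speed] has an unspecified
   value; adding that value keeps the bound valid at every [t]. *)
pose B := Num.sqrt (sqn v) / b + Num.sqrt (sqn v') / b + speed c 2^-1.
have sq_ge0 u : 0 <= Num.sqrt (sqn u) / b by rewrite divr_ge0 ?sqrtr_ge0 ?ltW.
have cB t : 0 <= t <= 1 -> speed c t <= B.
  move=> _; case: (ltgtP t 2^-1) => t2.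
  - have nc : \forall u \near t, c u = cpar (s : chart M) (x + u *: v).
      have : t \in `]t - 1, 2^-1[ by rewrite in_itv /= t2 andbT; lra.
      move=> /near_in_itvoo; apply: filterS => u; rewrite in_itv /= => /andP[_ /ltW u2].
      by rewrite /c u2.
    have ci : cimg (s : chart M) (x + t *: v) by rewrite cimg_sphere.
    rewrite (speed_affine (M := M) sphere_transition_diff ci nc).
    apply: le_trans (sphere_metric_le _ _) _; rewrite /B -addrA lerDl.
    by rewrite addr_ge0// speed_ge0.
  - have nc : \forall u \near t, c u = cpar (s' : chart M) (y' + u *: v').
      have : t \in `]2^-1, t + 1[ by rewrite in_itv /= t2 /=; lra.
      move=> /near_in_itvoo; apply: filterS => u; rewrite in_itv /= => /andP[/ltW u2 _].
      exact: cE.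
    have ci : cimg (s' : chart M) (y' + t *: v') by rewrite cimg_sphere.
    rewrite (speed_affine (M := M) sphere_transition_diff ci nc).
    apply: le_trans (sphere_metric_le _ _) _; rewrite /B addrAC lerDr.
    by rewrite addr_ge0// speed_ge0.
  - by rewrite t2 /B lerDr addr_ge0.
have dB (t : R) : is_derive t (1 : R) (fun u : R => B * u) B.
  by rewrite -[X in is_derive _ _ _ X]mulr1; apply: is_derive_cmul; exact: is_derive_id.
apply: le_lt_trans (curve_length_le cB dB (@cst_continuous _ _ _)) _.
exact: ltry.
Qed.

Let abs_coord_le x j : `|x 0 j| <= Num.sqrt (sqn x).
Proof.
rewrite -sqrtr_sqr ler_sqrt ?dot_ge0// /sqn /dot (bigD1 j)//= -expr2 lerDl.
by apply: sumr_ge0 => k _; rewrite -expr2 sqr_ge0.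
Qed.

Let abs_dot_le x v : `|dot x v| <= Num.sqrt (sqn x) * Num.sqrt (sqn v).
Proof.
rewrite -sqrtrM ?dot_ge0// -sqrtr_sqr ler_sqrt ?mulr_ge0 ?dot_ge0//.
exact: dot_sqr_le.
Qed.

Let inv_factor x v : Num.sqrt (inner (conf_metric b a x) v v) =
  2 * rho * (Num.sqrt (sqn v) * (1 + sqn x)^-1).
Proof.
rewrite sqrt_conf_metric// factorE invf_div /sqn; field.
by rewrite gt_eqF// sqn1_gt0.
Qed.

Let q1 x : 1 + sqn x != 0.
Proof. by rewrite gt_eqF// sqn1_gt0. Qed.

Let Ck_inv1 k : Ck_on k setT (fun x : 'rV[R]_n => (1 + sqn x)^-1).
Proof.
apply: (Ck_onV openT) => [x _|]; first exact: q1.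
by apply: (Ck_onD openT (Ck_on_cst k _ 1)); apply: Ck_on_sqn openT.
Qed.

Let diff_inv1 x : differentiable (fun x : 'rV[R]_n => (1 + sqn x)^-1) x.
Proof.
apply: differentiableV; last exact: q1.
by apply: differentiableD; [exact: differentiable_cst|exact: differentiable_sqn].
Qed.

Let derive_inv1 x v : is_derive x v (fun x : 'rV[R]_n => (1 + sqn x)^-1)
  (- (2 * dot x v / (1 + sqn x) ^+ 2)).
Proof.
apply: is_derive_inv; first exact: q1.
by have := is_derive_add (is_derive_cst (1 : R) x v) (is_derive_sqn x v);
  rewrite add0r.
Qed.

Let Ck1_partial (L : 'rV[R]_n -> R) x j : Ck_on 1 setT L ->
  {for x, continuous (partial j L)}.
Proof. by move=> [_ /(_ j) [_ [+ _]]]; exact. Qed.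

(** The factor [1 / 3] pays for a crude estimate: with [D = (1 + |x|^2)^-1], the product rule gives
    two terms bounded by [D |v|] and [2 D |v|]. Completeness only requires some positive
    constant. *)
Lemma sphere_fst_lipschitz j :
  metric_lipschitz (fun z : M => rho / 3 * (set_val z).1 0 j).
Proof.
move=> s x _; set L := _ \o _.
have LE : L = fun y => 2 * (rho / 3) * ((1 + sqn y)^-1 * y 0 j).
  apply/funext => y; rewrite -[L y]/(rho / 3 * (stereo s y).1 0 j) /stereo /= mxE.
  by field; exact: q1.
have dL v : is_derive x v L (2 * (rho / 3) *
    ((1 + sqn x)^-1 * v 0 j + x 0 j * - (2 * dot x v / (1 + sqn x) ^+ 2))).
  rewrite LE; apply: is_derive_cmul; apply: is_derive_mul; first exact: derive_inv1.
  exact: is_derive_coord.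
split.
- rewrite LE; apply: differentiableZ.
  by apply: differentiableM; [exact: diff_inv1|exact: differentiable_coord].
- move=> k; apply: Ck1_partial; rewrite LE.
  apply: (Ck_onM openT (Ck_on_cst 1 _ _)).
  by apply: (Ck_onM openT (Ck_inv1 1) (Ck_on_coord 1 _ j)).
- move=> v; have [_ ->] := dL v; rewrite inv_factor.
  set D := (1 + sqn x)^-1; set N := Num.sqrt (sqn v); set q := Num.sqrt (sqn x).
  have D0 : 0 < D by rewrite invr_gt0 sqn1_gt0.
  have N0 : 0 <= N by exact: sqrtr_ge0.
  have qE : q * q = sqn x by rewrite -expr2 sqr_sqrtr// dot_ge0.
  have qD : q * q * D <= 1.
    by rewrite qE /D ler_pdivrMr ?sqn1_gt0// mul1r lerDr.
  have h1 : `|D * v 0 j| <= D * N by rewrite normrM gtr0_norm// ler_pM2l// abs_coord_le.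
  have h2 : `|x 0 j * - (2 * dot x v / (1 + sqn x) ^+ 2)| <= 2 * (D * N).
    rewrite normrM normrN -exprVn -/D normrM (ger0_norm (sqr_ge0 D)) normrM normr_nat.
    apply: (@le_trans _ _ (q * (2 * (q * N) * D ^+ 2))).
      apply: ler_pM; [by []|by rewrite mulr_ge0 ?sqr_ge0 ?mulr_ge0|exact: abs_coord_le|].
      by rewrite ler_wpM2r ?sqr_ge0// ler_wpM2l//; exact: abs_dot_le.
    rewrite (_ : q * _ = q * q * D * (2 * (D * N))); last by ring.
    by rewrite ler_piMl// mulr_ge0// mulr_ge0// ltW.
  rewrite normrM ger0_norm; last by rewrite mulr_ge0// divr_ge0// ltW.
  apply: (@le_trans _ _ (2 * (rho / 3) * (D * N + 2 * (D * N)))).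
    apply: ler_wpM2l; first by rewrite mulr_ge0// divr_ge0// ltW.
    by apply: le_trans (ler_normD _ _) _; exact: lerD.
  by rewrite le_eqVlt; apply/orP; left; apply/eqP; field.
Qed.

Lemma sphere_snd_lipschitz :
  metric_lipschitz (fun z : M => rho / 3 * (set_val z).2).
Proof.
move=> s x _; set L := _ \o _; set e : R := (-1) ^+ s.
have e1 : `|e| = 1 by rewrite normr_sign.
have LE : L = fun y => 2 * (rho / 3) * e * (1 + sqn y)^-1 + - (rho / 3 * e).
  apply/funext => y; rewrite -[L y]/(rho / 3 * (stereo s y).2) /stereo /= -/e.
  by field; exact: q1.
have dL v : is_derive x v L (2 * (rho / 3) * e *
    - (2 * dot x v / (1 + sqn x) ^+ 2)).
  rewrite LE; have := is_derive_add (is_derive_cmul (2 * (rho / 3) * e)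
    (derive_inv1 x v)) (is_derive_cst (- (rho / 3 * e)) x v).
  by rewrite addr0.
split.
- rewrite LE; apply: differentiableD; last exact: differentiable_cst.
  by apply: differentiableZ; exact: diff_inv1.
- move=> k; apply: Ck1_partial; rewrite LE.
  apply: (Ck_onD openT _ (Ck_on_cst 1 _ _)).
  exact: (Ck_onM openT (Ck_on_cst 1 _ _) (Ck_inv1 1)).
- move=> v; have [_ ->] := dL v; rewrite inv_factor.
  rewrite normrM normrN -exprVn; set D := (1 + sqn x)^-1.
  set N := Num.sqrt (sqn v); set q := Num.sqrt (sqn x).
  have D0 : 0 < D by rewrite invr_gt0 sqn1_gt0.
  have N0 : 0 <= N by exact: sqrtr_ge0.
  have q0 : 0 <= q by exact: sqrtr_ge0.
  have qE : q ^+ 2 = sqn x by rewrite sqr_sqrtr// dot_ge0.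
  (* This is [2 q <= 1 + q^2]. The factor [1 / 3] is kept so that [coord_cauchy] handles all ambient
     coordinates with one constant. *)
  have qD : 2 * q * D <= 1.
    rewrite /D ler_pdivrMr ?sqn1_gt0// mul1r -qE -subr_ge0.
    by rewrite (_ : _ - _ = (1 - q) ^+ 2) ?sqr_ge0//; ring.
  rewrite normrM e1 mulr1 ger0_norm; last by rewrite mulr_ge0// divr_ge0// ltW.
  rewrite normrM (ger0_norm (sqr_ge0 D)) normrM normr_nat.
  apply: (@le_trans _ _ (2 * (rho / 3) * (2 * (q * N) * D ^+ 2))).
    apply: ler_wpM2l; first by rewrite mulr_ge0// divr_ge0// ltW.
    by rewrite ler_wpM2r ?sqr_ge0// ler_wpM2l//; exact: abs_dot_le.
  rewrite [leLHS](_ : _ = 2 * q * D * (2 * rho * (N * D) / 3)); last by field.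
  apply: (@le_trans _ _ (2 * rho * (N * D) / 3)).
    by rewrite ler_piMl// divr_ge0// !mulr_ge0// ltW.
  by rewrite ler_pdivrMr// ler_peMr ?ler1n// !mulr_ge0// ltW.
Qed.

Let coord_cauchy (f : M -> R) (u : nat -> M) :
  metric_lipschitz (fun z : M => rho / 3 * f z) -> metric_cauchy (rdist (M := M)) u ->
  cvgn (f \o u).
Proof.
move=> Lf cu; have r3 : 0 < rho / 3 by rewrite divr_gt0.
apply/cauchy_cvgP/cauchy_exP => e e0.
have [N HN] := cu (rho / 3 * e) (mulr_gt0 r3 e0).
exists (f (u N)); exists N => // k /= Nk; rewrite -ball_normE /=.
have [c [pc c0 c1 lc]] := sphere_finite_path (u k) (u N).
have := metric_lipschitz_le_rdist (M := M) sphere_transition_diff Lf pc lc.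
rewrite c0 c1 -mulrBr normrM gtr0_norm// => h.
by rewrite -(ltr_pM2l r3) (le_lt_trans h)// HN.
Qed.

Let cvg_rV (u : nat -> 'rV[R]_n) (l : 'rV[R]_n) :
  (forall j, u k 0 j @[k --> \oo] --> l 0 j) -> u @ \oo --> l.
Proof.
move=> ul U [P PH PU].
have : \forall k \near \oo, forall j, P 0 j (u k 0 j).
  by apply: filter_forall => j; exact: ul _ (PH 0 j).
by apply: filterS => k Pk; apply: PU => i j; rewrite ord1.
Qed.

(** The ambient coordinates of a Cauchy sequence converge, because multiples of them are
    1-Lipschitz, and the limit satisfies the equation of the sphere. In a chart around the limit,
    [rdist] is at most a constant times the Euclidean distance of coordinates, which tends to 0. *)
Lemma sphere_complete : metric_complete (rdist (M := M)).
Proof.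
move=> u cu; pose p k : 'rV[R]_n * R := set_val (u k).
pose l1 : 'rV[R]_n := \row_j lim ((p k).1 0 j @[k --> \oo]).
pose l2 : R := lim ((p k).2 @[k --> \oo]).
have cl1 : (p k).1 @[k --> \oo] --> l1.
  apply: cvg_rV => j; rewrite mxE.
  exact: (coord_cauchy (f := fun z : M => (set_val z).1 0 j) (sphere_fst_lipschitz j) cu).
have cl2 : (p k).2 @[k --> \oo] --> l2.
  exact: (coord_cauchy (f := fun z : M => (set_val z).2) sphere_snd_lipschitz cu).
have cl : p @ \oo --> (l1, l2).
  have pE : (fun k => ((p k).1, (p k).2)) = p.
    by apply/funext => k; rewrite -surjective_pairing.
  by rewrite -pE; exact: cvg_pair cl1 cl2.
have lS : unit_sphere (l1, l2).
  have h1 : sqn (p k).1 + (p k).2 ^+ 2 @[k --> \oo] --> sqn l1 + l2 ^+ 2.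
    have cq : sqn (p k).1 @[k --> \oo] --> sqn l1.
      exact: (cvg_comp _ _ cl1 (@continuous_sqn _ _ l1)).
    exact: cvgD cq (cvgM cl2 cl2).
  have h2 : sqn (p k).1 + (p k).2 ^+ 2 @[k --> \oo] --> (1 : R).
    rewrite (_ : (fun k => _) = cst 1); first exact: cvg_cst.
    by apply/funext => k; exact: (set_valP (u k)).
  exact: (cvg_unique _ h1 h2).
pose z : M := SigSub (mem_set lS).
pose s := sphere_chart_at z.
have zs : sphere_cdom s z := sphere_chart_atP z.
pose y k := sphere_coord s (u k).
have cy : y @ \oo --> sphere_coord s z.
  exact: (cvg_comp _ _ cl (stereo_coord_continuous zs)).
exists z.
have us : \forall k \near \oo, sphere_cdom s (u k).
  have nz : nbhs (1 + (-1) ^+ s * (l1, l2).2) [set t : R | t != 0].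
    by apply: open_nbhs_nbhs; split => //; exact: open_neq.
  exact: (cl _ (@denom_continuous _ _ s (l1, l2) _ nz)).
pose h (x : 'rV[R]_n) := Num.sqrt (sqn (x - sphere_coord s z)) / b.
have ch : h (y k) @[k --> \oo] --> (0 : R).
  have -> : (0 : R) = Num.sqrt (sqn (sphere_coord s z - sphere_coord s z)) / b.
    by rewrite subrr (eqP (_ : sqn 0 == 0)) ?sqn_eq0// sqrtr0 mul0r.
  apply: cvgM; last exact: cvg_cst.
  apply: continuous_cvg; first exact: sqrt_continuous.
  apply: continuous_cvg; first exact: continuous_sqn.
  by apply: cvgB => //; exact: cvg_cst.
apply: (squeeze_cvgr _ (@cvg_cst _ (0 : R) _ _ _) ch).
apply: filterS us => k uk; rewrite rdist_ge0 /=.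
rewrite -{1}(sphere_coordK zs) -(sphere_coordK uk).
rewrite /h /y; exact: sphere_rdist_le.
Qed.

End RoundSphere.

(** * Spheres and thin boxes are not tetrahedral *)

Lemma small_sphere_not_tetrahedral (R : realType) (X : Type) (d : X -> X -> R)
    (n : nat) (C beta r : R) (p : X) :
  0 < r -> 0 < C -> 0 <= beta ->
  (forall x y, d x p = r -> d y p = r -> x = y) -> ~ tetrahedral d n C beta r.
Proof.
(* The radii [t i = r] are admissible for every [beta >= 0], whatever the points [q i] are. *)
move=> r0 C0 b0 sp /(_ p) [q [_ /(_ (fun=> r))]].
have tr : forall _ : 'I_n.-1, (1 - beta) * r <= r <= (1 + beta) * r.
  by move=> _; apply/andP; split; nra.
move=> /(_ tr); rewrite /tetra_h; case: asboolP.
  by move=> [x [y [[xp _] [yp _] xy]]]; case: xy; exact: sp.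
by move=> _; rewrite leNgt mulr_gt0.
Qed.

Section Examples.
Context {R : realType} {n : nat} (i0 : 'I_n) (kappa r : R).
Hypothesis r_gt0 : 0 < r.

Lemma small_sphere_example : exists M : riemannian_manifold R n,
  [/\ sec_bounded_below M kappa, metric_complete (rdist (M := M)) &
      exists p : M, forall x y : M, rdist x p = r -> rdist y p = r -> x = y].
Proof.
(* The bound [r / pi] makes half a great circle no longer than [r]; the other one gives
   [rho^-2 >= (1 + |kappa|)^2 >= kappa]. *)
pose rho := Num.min (r / pi) (1 + `|kappa|)^-1.
have k0 : 0 < 1 + `|kappa| by rewrite ltr_pwDl.
have rho0 : 0 < rho by rewrite lt_min divr_gt0 ?pi_gt0// invr_gt0.
have rho_r : pi * rho <= r.
  by rewrite mulrC -ler_pdivlMr ?pi_gt0// ge_min lexx.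
have rho_k : kappa <= rho ^- 2.
  have h : 1 + `|kappa| <= rho^-1.
    by rewrite -[leLHS]invrK lef_pV2 ?posrE ?invr_gt0// ge_min lexx orbT.
  have := ler_norm kappa; rewrite -exprVn; nra.
exists (sphere_riemannian i0 rho0); split.
- exact: sphere_sec_bounded_below.
- exact: sphere_complete.
exists (sphere_cpar true 0 : sphere_riemannian i0 rho0).
(* Only the antipode of the centre may lie at distance [r]. *)
have sphereP (x : sphere_riemannian i0 rho0) :
    rdist x (sphere_cpar true 0 : sphere_riemannian i0 rho0) = r ->
    (set_val (x : unit_sphere)) = (0, 1).
  move=> xr; have [xt|xt] := pselect (sphere_cdom true x).
    have := sphere_rdist_lt i0 rho0 true (sphere_coord true x).
    by rewrite sphere_coordK// xr => /lt_le_trans /(_ rho_r); rewrite ltxx.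
  pose z : 'rV[R]_n * R := set_val (x : unit_sphere).
  have zS : sqn z.1 + z.2 ^+ 2 = 1 := set_valP (x : unit_sphere).
  have : 1 + (-1) ^+ true * z.2 = 0 by apply/eqP; move/negP: xt; rewrite negbK.
  rewrite expr1 => z20; have z2 : z.2 = 1 by lra.
  have z1 : z.1 = 0 by apply/eqP; rewrite -sqn_eq0; apply/eqP; rewrite z2 in zS; lra.
  by rewrite -/z [z]surjective_pairing z1 z2.
by move=> x y /sphereP xE /sphereP yE; apply: val_inj; rewrite [LHS]xE.
Qed.

Lemma thin_box_example : exists M : riemannian_manifold R n,
  [/\ sec_bounded_below M kappa, (r%:E < diameter (rdist (M := M)))%E &
      exists p : M, forall x : M, rdist x p < r].
Proof.
have r0 : 0 < r := r_gt0.
have n0 : (0 < n)%N by case: n i0 => // -[].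
have k_ge0 := normr_ge0 kappa.
(* The curvature of the box will be at least [A - A / 8], which exceeds [kappa] once
   [A >= 2 |kappa|]. The bound [2 <= A] serves the choice of [dl]. *)
have [A A2 Ak] : exists2 A : R, 2 <= A & 2 * `|kappa| <= A.
  by exists (2 * (1 + `|kappa|)); lra.
have N1 : 1 <= n%:R :> R by rewrite ler1n.
have A0 : 0 < A by lra.
have N0 : 0 < n%:R :> R by lra.
(* The bound [1 / 8] keeps [phi] below [17 / 16] and the negative term of the curvature below
   [A / 8]; the bound [r^2 / 8] keeps the corners of the box closer than [r] to its centre. *)
have [dl [dl0 dl1 dlr]] : exists dl : R, [/\ 0 < dl,
    n%:R * A * dl ^+ 2 <= 1 / 8 & n%:R * A * dl ^+ 2 <= r ^+ 2 / 8].
  set m := Num.min 1 r; have m0 : 0 < m by rewrite lt_min ltr01.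
  have D0 : 0 < 2 * n%:R * A by rewrite !mulr_gt0.
  (* With this value [n A dl^2 = m^2 / (4 n A)], which is at most [m^2 / 8] because [n A >= 2]. *)
  exists (m / (2 * n%:R * A)).
  have dl_le (c : R) : 0 <= c -> m <= c ->
      n%:R * A * (m / (2 * n%:R * A)) ^+ 2 <= c ^+ 2 / 8.
    move=> c0 mc; rewrite [leLHS](_ : _ = m ^+ 2 * (4 * (n%:R * A))^-1); last first.
      by field; rewrite !gt_eqF.
    apply: ler_pM; [exact: sqr_ge0|by rewrite invr_ge0 !mulr_ge0// ltW| |].
      by rewrite ler_pXn2r ?nnegrE// ltW.
    by rewrite lef_pV2 ?posrE ?mulr_gt0//; nra.
  split; first by rewrite divr_gt0.
    by have := dl_le 1; rewrite expr1n; apply; rewrite // ge_min lexx.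
  by apply: dl_le; [exact: ltW|rewrite ge_min lexx orbT].
pose a i := if i == i0 then 0 else A.
pose w i := if i == i0 then 3 / 4 * r else dl.
have w0 i : 0 < w i.
  by rewrite /w; case: ifP => // _; rewrite mulr_gt0// divr_gt0.
have a0 i : 0 <= a i by rewrite /a; case: ifP => // _; exact: ltW.
have sum_le (c : R) : \sum_(i < n) c = n%:R * c.
  by rewrite sumr_const card_ord mulr_natl.
have sq_le (x : 'rV[R]_n) i : box w x -> i != i0 -> x 0 i ^+ 2 <= dl ^+ 2.
  move=> bx ii0; rewrite -[x 0 i ^+ 2]real_normK ?num_real//.
  rewrite ler_pXn2r ?nnegrE// ?ltW//.
  by have := bx i; rewrite /w (negbTE ii0).
have factor_le (x : 'rV[R]_n) : box w x -> conf_factor 1 a x <= 17 / 16.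
  move=> bx; rewrite /conf_factor.
  have : \sum_i a i * (x 0 i * x 0 i) / 2 <= \sum_(i < n) A * dl ^+ 2 / 2.
    apply: ler_sum => i _; rewrite ler_pM2r ?invr_gt0//.
    rewrite /a; case: eqP => [_|/eqP ii0].
      by rewrite mul0r mulr_ge0 ?sqr_ge0//; lra.
    by rewrite ler_wpM2l -?expr2 ?sq_le//; lra.
  by rewrite sum_le; lra.
exists (box_riemannian w0 ltr01 a0); split.
- apply: box_sec_bounded_below => x bx i j ij.
  (* Two distinct indices cannot both be [i0], so at least one of the two coefficients is [A]. *)
  have aij : A <= a i + a j.
    rewrite /a; case: eqP => [ii0|_]; last by have := a0 j; rewrite /a; lra.
    by rewrite -ii0 eq_sym (negbTE ij) add0r.
  have : \sum_k (a k * x 0 k) ^+ 2 <= \sum_(k < n) A * (A * dl ^+ 2).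
    apply: ler_sum => k _; rewrite exprMn /a; case: eqP => [_|/eqP kk0].
      by rewrite expr0n mul0r !mulr_ge0 ?sqr_ge0//; lra.
    by rewrite expr2 -mulrA !ler_wpM2l ?sq_le//; lra.
  rewrite sum_le; have := conf_factor_ge 1 a0 x.
  have : n%:R * (A * (A * dl ^+ 2)) <= A / 8.
    rewrite (_ : _ * _ = A * (n%:R * A * dl ^+ 2)); last by ring.
    by rewrite ler_pM2l//; lra.
  have := ler_norm kappa.
  move: (\sum_k _) (conf_factor _ _ _) (n%:R * _) => S' P N' ? ? ? ?.
  have : P * A <= P * (a i + a j) by rewrite ler_pM2l//; lra.
  nra.
- pose y (c : R) : 'rV[R]_n := c *: delta_mx 0 i0.
  have by_ c : `|c| < 3 / 4 * r -> box w (y c).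
    move=> cr i; rewrite !mxE eqxx /=; rewrite /w; case: eqP => _.
      by rewrite mulr1.
    by rewrite mulr0 normr0.
  (* Since [5 / 7 < 3 / 4], the points of coordinates [c] and [- c] on the long axis lie in the box,
     and as [phi <= 17 / 16] their distance is at least [16 / 17 * (10 / 7) * r = 160 / 119 * r >
     r]. *)
  pose c := 5 / 7 * r.
  have bc : box w (y c) by apply: by_; rewrite ger0_norm /c; lra.
  have bNc : box w (y (- c)) by apply: by_; rewrite normrN ger0_norm /c; lra.
  apply: (@lt_le_trans _ _ (rdist (to_box w0 (y c) : box_riemannian w0 ltr01 a0)
      (to_box w0 (y (- c))))%:E); last first.
    by apply: ereal_sup_ubound;
      exists (to_box w0 (y c), to_box w0 (y (- c))).
  rewrite lte_fin.
  have := @box_rdist_ge _ _ _ w0 _ _ ltr01 a0 (16 / 17) i0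
    (to_box w0 (y c)) (to_box w0 (y (- c))).
  have c0 : 0 <= 16 / 17 :> R by lra.
  have cf z : box w z -> 16 / 17 * conf_factor 1 a z <= 1.
    by move=> /factor_le; lra.
  move=> /(_ c0 cf); apply: lt_le_trans.
  rewrite !to_boxE// !mxE !eqxx !mulr1 -opprD normrN ger0_norm /c; lra.
(* As [phi >= 1], distances are at most Euclidean, and the squared Euclidean distance to the centre
   is at most [(9 / 16 + 1 / 8) r^2 < r^2]. *)
- exists (to_box w0 0) => x.
  have := box_rdist_le x (to_box w0 0 : box_riemannian w0 ltr01 a0); rewrite divr1 => /le_lt_trans; apply.
  rewrite to_boxE ?sub0r; last exact: box0.
  have bx : box w (set_val (x : box w)) by exact: set_valP.
  move: bx; move: (set_val _) => z bx.
  have -> : dot (- z) (- z) = \sum_i z 0 i ^+ 2.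
    by apply: eq_bigr => i _; rewrite !mxE; ring.
  rewrite -[ltRHS]ger0_norm ?ltW// -sqrtr_sqr ltr_sqrt ?exprn_gt0//.
  rewrite (bigD1 i0)//=.
  have h1 : z 0 i0 ^+ 2 <= (3 / 4 * r) ^+ 2.
    have z0 : `|z 0 i0| <= 3 / 4 * r.
      by apply: ltW; have := bx i0; rewrite /w eqxx.
    rewrite -[z 0 i0 ^+ 2]real_normK ?num_real//.
    by rewrite !expr2 ler_pM.
  have h2 : \sum_(i < n | i != i0) z 0 i ^+ 2 <= n%:R * dl ^+ 2.
    rewrite -sum_le [leRHS](bigD1 i0)//= -[leLHS]add0r.
    by apply: lerD; [exact: sqr_ge0|apply: ler_sum => i; exact: sq_le].
  have h3 : n%:R * dl ^+ 2 <= n%:R * A * dl ^+ 2.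
    by rewrite ler_wpM2r ?sqr_ge0// ler_peMr//; lra.
  have : 0 < r ^+ 2 by rewrite exprn_gt0.
  by rewrite exprMn in h1; lra.
Qed.

End Examples.

Theorem corollary3p5 (R : realType) (n : nat) (hn : (0 < n)%N) (kappa : R)
    (r C beta : R) (hr : 0 < r) (hC : 0 < C) (hbeta : 0 < beta < 1) :
  (exists M : riemannian_manifold R n,
      sec_bounded_below M kappa /\
      ~ tetrahedral (rdist (M := M)) n C beta r) /\
  (exists M : riemannian_manifold R n,
      [/\ sec_bounded_below M kappa,
          (r%:E < diameter (rdist (M := M)))%E &
          ~ tetrahedral (rdist (M := M)) n C beta r]) /\
  (exists M : riemannian_manifold R n,
      [/\ sec_bounded_below M kappa,
          metric_complete (rdist (M := M)) &
          ~ tetrahedral (rdist (M := M)) n C beta r]).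
Proof.
have beta0 : 0 <= beta by case/andP: hbeta => /ltW.
have [S [secS cS [p pS]]] := small_sphere_example (Ordinal hn) kappa hr.
have [B [secB dB [q qB]]] := thin_box_example (Ordinal hn) kappa hr.
have notS : ~ tetrahedral (rdist (M := S)) n C beta r.
  exact: small_sphere_not_tetrahedral pS.
have notB : ~ tetrahedral (rdist (M := B)) n C beta r.
  apply: (small_sphere_not_tetrahedral (p := q)) => // x y xr.
  by have := qB x; rewrite xr ltxx.
by split; [exists S|split; [exists B|exists S]].
Qed.
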